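(* Let $\psi\in\Sigma$ and $Q_e(z,w)=\log\frac{\psi(z)-\psi(w)}{z-w}$. For $j=1,2,3,\dots$ and $z\in\mathbb{D}_e$, $$\mathrm{S}_{2j+2}(\psi)(z)=\frac{2j+1}{2j+3}\sum_{k=1}^{j}(-1)^{j+k-1}C_{k,j}\,\partial_z^{2j+2-2k}\mathrm{S}_{2k}(\psi)(z)+(-1)^j\frac{2j+1}{2j+3}\sum_{l=1}^{2j-1}\binom{2j}{l}A_{2j-l}(z)\,A_l(z),$$ where $$C_{k,j}=\frac{j-\frac12}{2j-k}\binom{2j-k}{k-1}-\frac{j(2j+3)}{(2j+1)(2j+1-k)}\binom{2j+1-k}{k-1}$$ and $A_n(z)=(\partial_z^n\partial_wQ_e)(z,z)$, which is calculated by $A_1=\mathrm{S}_2(\psi)$ and, for $n\ge2$, $$A_n(z)=\frac{n-1}{2}\sum_{k=1}^{\lfloor\frac{n+1}{2}\rfloor}\frac{(-1)^{k+1}}{n-k}\binom{n-k}{k-1}\,\partial_z^{n+1-2k}\mathrm{S}_{2k}(\psi)(z).$$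
   Context: $\mathbb{D}_e=\{z\in\mathbb{C}:|z|>1\}$. $\Sigma$ is the class of univalent (injective holomorphic) functions $\psi:\mathbb{D}_e\to\mathbb{C}$ with Laurent expansion $\psi(z)=z+b_0+b_1z^{-1}+\cdots$. $Q_e$ is the holomorphic function on $\mathbb{D}_e^2$ (quotient read as $\psi'(z)$ on $z=w$) given by the branch of the logarithm vanishing when $z=\infty$ or $w=\infty$. The diagonal series Schwarzian derivatives are $\mathrm{S}_{2n}(\psi)(z)=(\partial_z^n\partial_w^nQ_e)(z,z)$, $n=0,1,2,\dots$. *)

(* Defs.v *)
From Stdlib Require Import Reals.
From Coquelicot Require Import Coquelicot.

Local Open Scope C_scope.

Definition De (z : C) : Prop := (1 < Cmod z)%R.

(* Complex differentiability, with respect to the scalar field C. *)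
Definition holomorphic_on (D : C -> Prop) (f : C -> C) : Prop :=
  forall z : C, D z -> ex_derive (K := C_AbsRing) (V := C_NormedModule) f z.

(* Joint complex differentiability: the differential is C-linear on C * C. *)
Definition holomorphic2_on (D : C -> Prop) (Q : C -> C -> C) : Prop :=
  forall z w : C, D z -> D w ->
    ex_filterdiff (K := C_AbsRing)
      (U := prod_NormedModule C_AbsRing C_NormedModule C_NormedModule)
      (V := C_NormedModule)
      (fun p : C * C => Q (fst p) (snd p))
      (locally ((z, w) :
         prod_NormedModule C_AbsRing C_NormedModule C_NormedModule)).

(* Functions on De are total functions C -> C of which only the values on De
   are constrained.  The last field is the Laurent expansion
   psi z = z + b 0 + b 1 / z + b 2 / z^2 + ... *)
Record Sigma (psi : C -> C) : Prop := {
  Sigma_holo : holomorphic_on De psi;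
  Sigma_inj : forall z w : C, De z -> De w -> psi z = psi w -> z = w;
  Sigma_laurent : exists b : nat -> C, forall z : C, De z ->
    is_series (K := C_AbsRing) (V := C_NormedModule)
      (fun n : nat => b n / z ^ n) (psi z - z)
}.

Definition Cexp (z : C) : C :=
  ((exp (Re z) * cos (Im z))%R, (exp (Re z) * sin (Im z))%R).

(* The filter of neighbourhoods of the point at infinity of C. *)
Definition C_infty : (C -> Prop) -> Prop :=
  fun P => exists M : R, forall z : C, (M < Cmod z)%R -> P z.

(* Q is the holomorphic branch on De * De of
   log ((psi z - psi w) / (z - w)) (quotient read as psi' z for w = z)
   that vanishes when z or w is infinite.  These conditions determine Q
   on De * De. *)
Record is_Qe (psi : C -> C) (Q : C -> C -> C) : Prop := {
  Qe_holo : holomorphic2_on De Q;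
  Qe_off_diag : forall z w : C, De z -> De w -> z <> w ->
    Cexp (Q z w) = (psi z - psi w) / (z - w);
  Qe_diag : forall z : C, De z -> Cexp (Q z z) = C_derive psi z;
  Qe_infty_l : forall w : C, De w ->
    filterlim (fun z : C => Q z w) C_infty (locally (RtoC 0));
  Qe_infty_r : forall z : C, De z ->
    filterlim (fun w : C => Q z w) C_infty (locally (RtoC 0))
}.

Fixpoint C_derive_n (f : C -> C) (n : nat) : C -> C :=
  match n with
  | O => f
  | S n' => C_derive (C_derive_n f n')
  end.

(* (d/dz)^n (d/dw)^m Q at (z, w). *)
Definition mixed_derive (Q : C -> C -> C) (n m : nat) (z w : C) : C :=
  C_derive_n (fun z' : C => C_derive_n (fun w' : C => Q z' w') m w) n z.

(* The diagonal series Schwarzian of order 2n: diag_schwarzian Q n is S_{2n},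
   where Q is the function Q_e of psi. *)
Definition diag_schwarzian (Q : C -> C -> C) (n : nat) (z : C) : C :=
  mixed_derive Q n n z z.

Definition Acoef (Q : C -> C -> C) (n : nat) (z : C) : C :=
  mixed_derive Q n 1 z z.

Definition Ccoef (k j : nat) : R :=
  ((INR j - 1 / 2) / (2 * INR j - INR k)
     * Binomial.C (2 * j - k) (k - 1)
   - INR j * (2 * INR j + 3)
       / ((2 * INR j + 1) * (2 * INR j + 1 - INR k))
     * Binomial.C (2 * j + 1 - k) (k - 1))%R.

(* Main.v *)
Require Import Defs.
From Stdlib Require Import Reals Lra Lia Wf_nat FunctionalExtensionality.
From Coquelicot Require Import Coquelicot.

(** Laurent expansion turns [exp Q] into [G = 1 - x y H(x, y)] with [x = 1/z],
    [y = 1/w] and [H = sum_n b_(n+1) sum_(i+j=n) x^i y^j], also on the diagonal;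
    so [Q_z = G_z / G] and [Q_w = G_w / G] show that all partial derivatives
    of [Q] exist.  Write [q_(m,n)] for their values at [z = w].  They are
    symmetric in [m, n], hence [q_(a+m,a)] is expressed by derivatives of the
    [q_(k,k)] in the same way as [(x^m + y^m) (x y)^a / 2] is expressed by
    [x + y] and [x y]; with [a = 1] this is the formula for [A_n].

    Since [(z - w) exp Q = psi z - psi w], eliminating [psi] gives
    [(z - w) (Q_ww + Q_w^2) = 2 Q_w + 2 Q_w(w,w) ((z - w) Q_w - 1)].
    Differentiating [2j+1] times in [z] and putting [z = w], the extreme terms
    of the Leibniz sum cancel:
    [q_(2j,2) + sum_(0<l<2j) C(2j,l) A_(2j-l) A_l = 2/(2j+1) q_(2j+1,1)].
    Both [q]'s have expansions as above, and solving for [q_(j+1,j+1)]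
    gives the recursion. *)

Local Open Scope C_scope.

(** * Complex derivatives *)

(** The assumption on [Q] yields one complex derivative at each point, while the claim involves
    partial derivatives of every order on the diagonal, where the quotient is not a formula in psi.
    The Laurent series meets both needs: it gives a function that is analytic across the diagonal,
    and [Q] enters a differential algebra closed under both partial derivations, so no integral
    formula is required.

    The expansion of q_(a+m,a) rests on a dictionary sending q_(m,n) to x^m y^n. Differentiating
    along the diagonal becomes multiplication by x + y, and raising both indices becomes
    multiplication by x y. Symmetry replaces x^m by (x^m + y^m) / 2, a polynomial in x + y and x y
    by the Girard-Waring formula; this is the source of all the binomial coefficients in the
    statement.

    Only exp Q is visibly symmetric, since it determines Q up to a multiple of 2 pi i. Symmetry is
    therefore proved for derivatives of positive order only, and no others occur. *)

Definition cderive (f : C -> C) (z l : C) : Prop :=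
  is_derive (K := C_AbsRing) (V := AbsRing_NormedModule C_AbsRing) f z l.

Lemma cderive_eps (f : C -> C) (z l : C) :
  cderive f z l <->
  forall eps : R, (0 < eps)%R -> exists d : R, (0 < d)%R /\
    forall t : C, (Cmod (t - z) < d)%R ->
      (Cmod (f t - f z - (t - z) * l) <= eps * Cmod (t - z))%R.
Proof.
  split.
  - intros [_ H] eps He.
    destruct (H z (fun P HP => HP) (mkposreal eps He)) as [d Hd].
    exists d; split; [apply cond_pos|]. intros t Ht. exact (Hd t Ht).
  - intros H. split; [apply is_linear_scal_l|].
    intros x Hx. rewrite <- (is_filter_lim_locally_unique _ _ Hx).
    intros eps. destruct (H eps (cond_pos eps)) as [d [Hd H']].
    exists (mkposreal d Hd). intros t Ht. exact (H' t Ht).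
Qed.

(** The two module structures on the codomain carry the same norm. The product and chain rules are
    stated for the ring structure, [C_derive] for [C_NormedModule]. *)
Lemma is_derive_cderive (f : C -> C) (z l : C) :
  is_derive (K := C_AbsRing) (V := C_NormedModule) f z l <-> cderive f z l.
Proof.
  split; intros [_ H]; (split; [apply is_linear_scal_l|exact H]).
Qed.

Lemma C_derive_unique (f : C -> C) (z l : C) : cderive f z l -> C_derive f z = l.
Proof. intros H; apply is_C_derive_unique, is_derive_cderive, H. Qed.

Lemma cderive_unique (f : C -> C) (z l l' : C) :
  cderive f z l -> cderive f z l' -> l = l'.
Proof.
  intros H H'. now rewrite <- (C_derive_unique _ _ _ H), (C_derive_unique _ _ _ H').
Qed.

Lemma De_open (z : C) : De z ->
  exists d : R, (0 < d)%R /\ forall t : C, (Cmod (t - z) < d)%R -> De t.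
Proof.
  unfold De. intros Hz. exists (Cmod z - 1)%R. split; [lra|]. intros t Ht.
  pose proof (Cmod_triangle (z - t) t) as H.
  replace (z - t + t) with z in H by ring.
  replace (z - t) with (- (t - z)) in H by ring. rewrite Cmod_opp in H. lra.
Qed.

Lemma cderive_ext_De (f g : C -> C) (z l : C) : De z ->
  (forall t, De t -> f t = g t) -> cderive f z l -> cderive g z l.
Proof.
  intros Hz E. apply is_derive_ext_loc. destruct (De_open z Hz) as [d [Hd H]].
  exists (mkposreal d Hd). intros t Ht. now apply E, H.
Qed.

Lemma cderive_ext (f g : C -> C) (z l : C) :
  (forall t, f t = g t) -> cderive f z l -> cderive g z l.
Proof. exact (is_derive_ext (K := C_AbsRing) (V := AbsRing_NormedModule C_AbsRing) f g z l). Qed.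

Lemma cderive_eq (f : C -> C) (z l l' : C) : l = l' -> cderive f z l -> cderive f z l'.
Proof. now intros <-. Qed.

Lemma cderive_const (a z : C) : cderive (fun _ => a) z 0.
Proof. exact (is_derive_const (K := C_AbsRing) (V := AbsRing_NormedModule C_AbsRing) a z). Qed.

Lemma cderive_id (z : C) : cderive (fun t => t) z 1.
Proof. exact (is_derive_id (K := C_AbsRing) z). Qed.

Lemma cderive_plus (f g : C -> C) (z l m : C) :
  cderive f z l -> cderive g z m -> cderive (fun t => f t + g t) z (l + m).
Proof. exact (is_derive_plus (K := C_AbsRing) (V := AbsRing_NormedModule C_AbsRing) f g z l m). Qed.

Lemma cderive_mult (f g : C -> C) (z l m : C) :
  cderive f z l -> cderive g z m -> cderive (fun t => f t * g t) z (l * g z + f z * m).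
Proof.
  intros H H'. exact (is_derive_mult (K := C_AbsRing) f g z l m H H' Cmult_comm).
Qed.

Lemma cderive_scal (a : C) (f : C -> C) (z l : C) :
  cderive f z l -> cderive (fun t => a * f t) z (a * l).
Proof.
  intros H. apply (cderive_eq _ _ (0 * f z + a * l)); [ring|].
  exact (cderive_mult (fun _ => a) f z 0 l (cderive_const a z) H).
Qed.

Lemma cderive_comp (f g : C -> C) (z l m : C) :
  cderive f (g z) l -> cderive g z m -> cderive (fun t => f (g t)) z (m * l).
Proof. exact (is_derive_comp (K := C_AbsRing) (V := AbsRing_NormedModule C_AbsRing) f g z l m). Qed.

Lemma cderive_sum (f f' : nat -> C -> C) (z : C) (n : nat) :
  (forall k, (k <= n)%nat -> cderive (f k) z (f' k z)) ->
  cderive (fun t => sum_n (fun k => f k t) n) z (sum_n (fun k => f' k z) n).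
Proof.
  intros H. exact (is_derive_sum_n (K := C_AbsRing) (V := AbsRing_NormedModule C_AbsRing) f n z (fun k => f' k z) H).
Qed.

Lemma cderive_quadratic (f : C -> C) (z l : C) (K d : R) : (0 < d)%R ->
  (forall t, (Cmod (t - z) < d)%R ->
     (Cmod (f t - f z - (t - z) * l) <= K * Cmod (t - z) ^ 2)%R) ->
  cderive f z l.
Proof.
  intros Hd H. apply cderive_eps. intros eps He.
  pose proof (Rle_abs K) as HK. pose proof (Rabs_pos K) as HK0.
  (* K may be zero or negative, so the radius uses the positive number [Rabs K + 1]. *)
  assert (HK1 : (0 < Rabs K + 1)%R) by lra.
  pose proof (Rdiv_lt_0_compat _ _ He HK1) as Hq.
  exists (Rmin d (eps / (Rabs K + 1))). split; [now apply Rmin_glb_lt|].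
  intros t Ht. pose proof (Rmin_l d (eps / (Rabs K + 1))).
  pose proof (Rmin_r d (eps / (Rabs K + 1))).
  eapply Rle_trans; [apply H; lra|].
  set (u := Cmod (t - z)) in *. pose proof (Cmod_ge_0 (t - z)) as Hu. fold u in Hu.
  assert (E : (u * (Rabs K + 1) <= eps)%R).
  { apply Rmult_le_reg_r with (/ (Rabs K + 1))%R; [now apply Rinv_0_lt_compat|].
    rewrite Rmult_assoc, Rinv_r by lra. unfold Rdiv in *. lra. }
  nra.
Qed.

(** The remainder is exactly (t - z)^2 / (t z^2), and within |z| / 2 of z the factor 1 / |t| is at
    most 2 / |z|. *)
Lemma cderive_inv (z : C) : z <> 0 -> cderive (fun t => / t) z (- (/ z * / z)).
Proof.
  intros Hz. assert (Hm : (0 < Cmod z)%R) by now apply Cmod_gt_0.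
  apply (cderive_quadratic _ _ _ (2 / Cmod z ^ 3) (Cmod z / 2)); [lra|].
  intros t Ht.
  assert (Ht2 : (Cmod z / 2 <= Cmod t)%R).
  { pose proof (Cmod_triangle (z - t) t) as H.
    replace (z - t + t) with z in H by ring.
    replace (z - t) with (- (t - z)) in H by ring. rewrite Cmod_opp in H. lra. }
  assert (Ht0 : t <> 0) by (apply Cmod_gt_0; lra).
  replace (/ t - / z - (t - z) * - (/ z * / z))
    with ((t - z) * (t - z) * / t * (/ z * / z)) by now field.
  rewrite !Cmod_mult, !Cmod_inv by auto.
  assert (Hi : (/ Cmod t <= 2 / Cmod z)%R).
  { replace (2 / Cmod z)%R with (/ (Cmod z / 2))%R by (field; lra).
    apply Rinv_le_contravar; lra. }
  replace (2 / Cmod z ^ 3 * Cmod (t - z) ^ 2)%R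
    with (Cmod (t - z) * Cmod (t - z) * (2 / Cmod z) * (/ Cmod z * / Cmod z))%R
    by (field; lra).
  pose proof (Cmod_ge_0 (t - z)).
  apply Rmult_le_compat_r.
  { apply Rlt_le, Rmult_lt_0_compat; now apply Rinv_0_lt_compat. }
  apply Rmult_le_compat_l; [nra|exact Hi].
Qed.

(** * Complex series *)

Lemma Csum_O (f : nat -> C) : sum_n f 0 = f 0%nat.
Proof. exact (sum_O f). Qed.

Lemma Csum_S (f : nat -> C) (n : nat) : sum_n f (S n) = sum_n f n + f (S n).
Proof. exact (sum_Sn f n). Qed.

Lemma Csum_head (f : nat -> C) (n : nat) :
  sum_n f (S n) = f 0%nat + sum_n (fun k => f (S k)) n.
Proof.
  unfold sum_n. rewrite sum_Sn_m by lia. now rewrite <- sum_n_m_S.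
Qed.

Lemma Csum_ext (f g : nat -> C) (n : nat) :
  (forall k, (k <= n)%nat -> f k = g k) -> sum_n f n = sum_n g n.
Proof. exact (sum_n_ext_loc f g n). Qed.

Lemma Csum_plus (f g : nat -> C) (n : nat) :
  sum_n (fun k => f k + g k) n = sum_n f n + sum_n g n.
Proof. exact (sum_n_plus f g n). Qed.

Lemma Csum_scal (a : C) (f : nat -> C) (n : nat) :
  sum_n (fun k => a * f k) n = a * sum_n f n.
Proof. exact (sum_n_mult_l (K := C_Ring) a f n). Qed.

Lemma Cmod_sum_n_le (f : nat -> C) (b : R) (n : nat) :
  (forall k, (k <= n)%nat -> (Cmod (f k) <= b)%R) ->
  (Cmod (sum_n f n) <= (INR n + 1) * b)%R.
Proof.
  induction n as [|n IH]; intros H.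
  - rewrite Csum_O. simpl. specialize (H 0%nat (le_n _)). lra.
  - rewrite Csum_S, S_INR. eapply Rle_trans; [apply Cmod_triangle|].
    assert (H1 := IH (fun k Hk => H k ltac:(lia))). specialize (H (S n) (le_n _)). lra.
Qed.

(** Summation by components makes the theory of real series available. [Series] is total, so the
    value carries meaning only for convergent components. *)
Definition CSeries (u : nat -> C) : C :=
  (Series (fun n => Re (u n)), Series (fun n => Im (u n))).

Definition summable (u : nat -> C) : Prop := ex_series (fun n => Cmod (u n)).

Lemma Rabs_Re_le (z : C) : (Rabs (Re z) <= Cmod z)%R.
Proof. eapply Rle_trans; [apply Rmax_l|apply Rmax_Cmod]. Qed.

Lemma Rabs_Im_le (z : C) : (Rabs (Im z) <= Cmod z)%R.
Proof. eapply Rle_trans; [apply Rmax_r|apply Rmax_Cmod]. Qed.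

Lemma summable_le (u : nat -> C) (M : nat -> R) :
  (forall n, (Cmod (u n) <= M n)%R) -> ex_series M -> summable u.
Proof.
  intros H HM. apply (ex_series_le (K := R_AbsRing) (V := R_CompleteNormedModule) _ M); [|exact HM].
  intros n. unfold norm; simpl; unfold abs; simpl.
  rewrite Rabs_pos_eq by apply Cmod_ge_0. apply H.
Qed.

Lemma summable_Re (u : nat -> C) : summable u -> ex_series (fun n => Re (u n)).
Proof.
  intros H.
  exact (ex_series_le (K := R_AbsRing) (V := R_CompleteNormedModule)
           (fun n => Re (u n)) _ (fun n => Rabs_Re_le (u n)) H).
Qed.

Lemma summable_Im (u : nat -> C) : summable u -> ex_series (fun n => Im (u n)).
Proof.
  intros H.
  exact (ex_series_le (K := R_AbsRing) (V := R_CompleteNormedModule)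
           (fun n => Im (u n)) _ (fun n => Rabs_Im_le (u n)) H).
Qed.

Lemma CSeries_ext (u v : nat -> C) : (forall n, u n = v n) -> CSeries u = CSeries v.
Proof.
  intros H. unfold CSeries. f_equal; apply Series_ext; intros n; now rewrite H.
Qed.

Lemma summable_plus (u v : nat -> C) :
  summable u -> summable v -> summable (fun n => u n + v n).
Proof.
  intros Hu Hv. apply (summable_le _ (fun n => Cmod (u n) + Cmod (v n))%R).
  - intros n. apply Cmod_triangle.
  - exact (ex_series_plus _ _ Hu Hv).
Qed.

Lemma summable_scal (a : C) (u : nat -> C) : summable u -> summable (fun n => a * u n).
Proof.
  intros Hu. apply (summable_le _ (fun n => Cmod a * Cmod (u n))%R).
  - intros n. rewrite Cmod_mult. apply Rle_refl.
  - exact (ex_series_scal (Cmod a) _ Hu).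
Qed.

Lemma CSeries_plus (u v : nat -> C) : summable u -> summable v ->
  CSeries (fun n => u n + v n) = CSeries u + CSeries v.
Proof.
  intros Hu Hv. unfold CSeries, Cplus; simpl. f_equal; rewrite <- Series_plus;
    auto using summable_Re, summable_Im.
Qed.

Lemma CSeries_scal (a : C) (u : nat -> C) : summable u ->
  CSeries (fun n => a * u n) = a * CSeries u.
Proof.
  intros Hu. unfold CSeries, Cmult, Re, Im; simpl.
  pose proof (summable_Re u Hu) as HR. pose proof (summable_Im u Hu) as HI.
  assert (S : forall (r : R) (v : nat -> R), ex_series v -> ex_series (fun n => r * v n)%R).
  { intros r v. exact (ex_series_scal (K := R_AbsRing) r v). }
  f_equal; rewrite <- !Series_scal_l.
  - now rewrite <- Series_minus by now apply S.
  - now rewrite <- Series_plus by now apply S.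
Qed.

(** The factor 2 is a coarse sqrt 2, lost in passing from the two components to the modulus. *)
Lemma Cmod_CSeries_le (u : nat -> C) (M : nat -> R) :
  (forall n, (Cmod (u n) <= M n)%R) -> ex_series M ->
  (Cmod (CSeries u) <= 2 * Series M)%R.
Proof.
  intros H HM.
  assert (B : forall v : nat -> R, (forall n, (Rabs (v n) <= M n)%R) ->
    (Rabs (Series v) <= Series M)%R).
  { intros v Hv.
    assert (Hs : ex_series (fun n => Rabs (v n))).
    { apply (ex_series_le (K := R_AbsRing) (V := R_CompleteNormedModule) _ M); [|exact HM].
      intros n. unfold norm; simpl; unfold abs; simpl. now rewrite Rabs_Rabsolu. }
    eapply Rle_trans; [now apply Series_Rabs|].
    apply Series_le; [|exact HM]. intros n; split; [apply Rabs_pos|apply Hv]. }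
  assert (HR : (Rabs (Re (CSeries u)) <= Series M)%R).
  { apply B. intros n. eapply Rle_trans; [apply Rabs_Re_le|apply H]. }
  assert (HI : (Rabs (Im (CSeries u)) <= Series M)%R).
  { apply B. intros n. eapply Rle_trans; [apply Rabs_Im_le|apply H]. }
  eapply Rle_trans; [apply Cmod_2Rmax|].
  assert (HS : (sqrt 2 <= 2)%R).
  { rewrite <- (sqrt_Rsqr 2) at 2 by lra. apply sqrt_le_1_alt. unfold Rsqr; lra. }
  pose proof (Rabs_pos (Re (CSeries u))).
  apply Rmult_le_compat; [apply sqrt_pos| |exact HS|].
  - eapply Rle_trans; [|apply Rmax_l]. apply Rabs_pos.
  - apply Rmax_lub; assumption.
Qed.

Lemma CSeries_head (u : nat -> C) : summable u ->
  CSeries u = u 0%nat + CSeries (fun n => u (S n)).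
Proof.
  intros Hu. unfold CSeries. rewrite (Series_incr_1 (fun n => Re (u n))) by now apply summable_Re.
  rewrite (Series_incr_1 (fun n => Im (u n))) by now apply summable_Im. reflexivity.
Qed.

Lemma Re_sum_n (u : nat -> C) (n : nat) : Re (sum_n u n) = sum_n (fun k => Re (u k)) n.
Proof.
  induction n as [|n IH]; [now rewrite !sum_O|]. rewrite !sum_Sn, <- IH. reflexivity.
Qed.

Lemma Im_sum_n (u : nat -> C) (n : nat) : Im (sum_n u n) = sum_n (fun k => Im (u k)) n.
Proof.
  induction n as [|n IH]; [now rewrite !sum_O|]. rewrite !sum_Sn, <- IH. reflexivity.
Qed.

Lemma CSeries_unique (u : nat -> C) (l : C) :
  is_series (K := C_AbsRing) (V := C_NormedModule) u l -> CSeries u = l.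
Proof.
  intros H. rewrite (surjective_pairing l). unfold CSeries. f_equal.
  - apply is_series_unique.
    apply (filterlim_ext (fun n => Re (sum_n u n))); [intros n; apply Re_sum_n|].
    intros P [e He]. refine (H (fun s : C => P (Re s)) _). exists e. intros y [Hy _]. apply He, Hy.
  - apply is_series_unique.
    apply (filterlim_ext (fun n => Im (sum_n u n))); [intros n; apply Im_sum_n|].
    intros P [e He]. refine (H (fun s : C => P (Im s)) _). exists e. intros y [_ Hy]. apply He, Hy.
Qed.

(** From some index on the partial sums lie within 1 of the limit, so two consecutive ones differ by
    less than 2; the finitely many earlier terms have a maximum. *)
Lemma CSeries_terms_bounded (u : nat -> C) (l : C) :
  is_series (K := C_AbsRing) (V := C_NormedModule) u l ->
  exists K : R, forall n, (Cmod (u n) <= K)%R.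
Proof.
  intros H.
  assert (Hl : filterlim (fun n => sum_n u n) eventually (locally l)) by exact H.
  destruct (Hl (fun s => (Cmod (s - l) < 1)%R)) as [N HN].
  { apply (proj2 (locally_C l _)). exists (mkposreal 1 Rlt_0_1). intros y Hy. exact Hy. }
  assert (B : exists K, forall n, (n <= S N)%nat -> (Cmod (u n) <= K)%R).
  { generalize (S N) as m. induction m as [|m [K HK]].
    - exists (Cmod (u 0%nat)). intros n Hn. replace n with 0%nat by lia. apply Rle_refl.
    - exists (Rmax K (Cmod (u (S m)))). intros n Hn.
      destruct (Nat.eq_dec n (S m)) as [->|]; [apply Rmax_r|].
      eapply Rle_trans; [apply HK; lia|apply Rmax_l]. }
  destruct B as [K HK]. exists (Rmax K 2). intros n.
  destruct (Nat.le_gt_cases n (S N)) as [Hn|Hn].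
  - eapply Rle_trans; [now apply HK|apply Rmax_l].
  - eapply Rle_trans; [|apply Rmax_r].
    destruct n as [|n]; [lia|].
    replace (u (S n)) with ((sum_n u (S n) - l) + - (sum_n u n - l)).
    + eapply Rle_trans; [apply Cmod_triangle|]. rewrite Cmod_opp.
      assert (H1 := HN (S n) ltac:(lia)). assert (H2 := HN n ltac:(lia)).
      simpl in H1, H2. lra.
    + rewrite Csum_S. ring.
Qed.

(** * Power series on the bidisc *)

(** Bernoulli's inequality for (1 + x)^n, where 1 / p = 1 + x. *)
Lemma linear_geometric_bound (p : R) : (0 < p < 1)%R ->
  exists B : R, forall n : nat, ((INR n + 1) * p ^ n <= B)%R.
Proof.
  intros [H0 H1]. set (x := (/ p - 1)%R).
  assert (Hx : (0 < x)%R).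
  { unfold x. apply Rlt_0_minus. rewrite <- Rinv_1. now apply Rinv_lt_contravar; lra. }
  exists (1 + / x)%R. intros n. pose proof (poly n x Hx) as H.
  assert (Hp : (p ^ n * (1 + x) ^ n = 1)%R).
  { rewrite <- Rpow_mult_distr. replace (p * (1 + x))%R with 1%R by (unfold x; field; lra).
    apply pow1. }
  pose proof (pow_lt p n H0) as Hpn. pose proof (pos_INR n) as Hn.
  pose proof (Rinv_0_lt_compat x Hx) as Hix.
  assert (E : (INR n + 1 <= (1 + / x) * (1 + INR n * x))%R).
  { replace ((1 + / x) * (1 + INR n * x))%R with (INR n + 1 + INR n * x + / x)%R
      by (field; lra). nra. }
  apply Rle_trans with ((1 + / x) * ((1 + INR n * x) * p ^ n))%R.
  - rewrite <- Rmult_assoc. apply Rmult_le_compat_r; lra.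
  - rewrite <- (Rmult_1_r (1 + / x)) at 2. apply Rmult_le_compat_l; [lra|].
    rewrite <- Hp, Rmult_comm. apply Rmult_le_compat_l; lra.
Qed.

(** Splits r^n into two geometric factors: one bounds coefficients, the other is free to absorb
    powers of n. *)
Lemma sqrt_unit (r : R) : (0 < r < 1)%R -> exists p, (0 < p < 1)%R /\ r = (p ^ 2)%R.
Proof.
  intros [H0 H1]. exists (sqrt r). repeat split.
  - now apply sqrt_lt_R0.
  - rewrite <- sqrt_1. now apply sqrt_lt_1_alt; lra.
  - symmetry. apply pow2_sqrt. lra.
Qed.

(* These are the coefficient families of the power series in two variables
   that converge on the bidisc [|x|, |y| < 1]. *)
Definition bidisc_coef (c : nat -> nat -> C) : Prop :=
  forall r : R, (0 < r < 1)%R ->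
    exists K : R, forall i j, (Cmod (c i j) * r ^ (i + j) <= K)%R.

Definition dx (c : nat -> nat -> C) (i j : nat) : C := RtoC (INR (S i)) * c (S i) j.
Definition dy (c : nat -> nat -> C) (i j : nat) : C := RtoC (INR (S j)) * c i (S j).

Lemma Cmod_INR (n : nat) : Cmod (RtoC (INR n)) = INR n.
Proof. rewrite Cmod_R. apply Rabs_pos_eq, pos_INR. Qed.

(** The weight [INR (S m)] is the factor that [dx] or [dy] produces; the second factor p in r = p^2
    pays for it. *)
Lemma bidisc_coef_shift (c : nat -> nat -> C) (r : R) : bidisc_coef c -> (0 < r < 1)%R ->
  exists K : R, forall i j m, (m <= i + j)%nat ->
    (INR (S m) * Cmod (c i j) * r ^ (i + j) <= K)%R.
Proof.
  intros Hc Hr. destruct (sqrt_unit r Hr) as [p [Hp ->]].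
  destruct (Hc p Hp) as [K HK]. destruct (linear_geometric_bound p Hp) as [B HB].
  exists (K * B)%R. intros i j m Hm. specialize (HK i j). specialize (HB (i + j)%nat).
  pose proof (pow_lt p (i + j) (proj1 Hp)) as Hq. pose proof (Cmod_ge_0 (c i j)) as H0.
  rewrite <- pow_mult, Nat.mul_comm, pow_mult. rewrite S_INR.
  pose proof (le_INR _ _ Hm) as Hm'. pose proof (pos_INR m).
  set (q := (p ^ (i + j))%R) in *. set (a := Cmod (c i j)) in *.
  replace ((INR m + 1) * a * q ^ 2)%R with ((a * q) * ((INR m + 1) * q))%R by ring.
  apply Rmult_le_compat; [nra|nra|exact HK|nra].
Qed.

Lemma bidisc_coef_dx (c : nat -> nat -> C) : bidisc_coef c -> bidisc_coef (dx c).
Proof.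
  intros Hc r Hr. destruct (bidisc_coef_shift c r Hc Hr) as [K HK].
  exists (K / r)%R. intros i j. unfold dx. rewrite Cmod_mult, Cmod_INR.
  apply Rmult_le_reg_r with r; [lra|]. unfold Rdiv. rewrite (Rmult_assoc K), Rinv_l, Rmult_1_r by lra.
  specialize (HK (S i) j i ltac:(lia)). simpl plus in HK. simpl pow in HK. lra.
Qed.

Lemma bidisc_coef_dy (c : nat -> nat -> C) : bidisc_coef c -> bidisc_coef (dy c).
Proof.
  intros Hc r Hr. destruct (bidisc_coef_shift c r Hc Hr) as [K HK].
  exists (K / r)%R. intros i j. unfold dy. rewrite Cmod_mult, Cmod_INR.
  apply Rmult_le_reg_r with r; [lra|]. unfold Rdiv. rewrite (Rmult_assoc K), Rinv_l, Rmult_1_r by lra.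
  specialize (HK i (S j) j ltac:(lia)). rewrite Nat.add_succ_r in HK. simpl pow in HK. lra.
Qed.

(** Of the three powers of n + 1, two are for the second-order Taylor remainder of a monomial of
    degree n and one for the n + 1 monomials of that degree. *)
Lemma bidisc_coef_majorant (c : nat -> nat -> C) (r : R) : bidisc_coef c -> (0 < r < 1)%R ->
  exists M : nat -> R, ex_series M /\ forall n i, (i <= n)%nat ->
    ((INR n + 1) ^ 3 * (Cmod (c i (n - i)%nat) * r ^ n) <= M n)%R.
Proof.
  (* Three square roots give r = p^8: four factors p^n bound the coefficient, three absorb the cube
     of n + 1, and the last one remains as the summable geometric term. *)
  intros Hc Hr. destruct (sqrt_unit r Hr) as [s [Hs ->]].
  destruct (sqrt_unit s Hs) as [t [Ht ->]]. destruct (sqrt_unit t Ht) as [p [Hp ->]].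
  destruct (Hc _ Hs) as [K HK]. destruct (linear_geometric_bound p Hp) as [B HB].
  exists (fun n => K * B ^ 3 * p ^ n)%R. split.
  { apply (ex_series_scal (K := R_AbsRing) (V := R_NormedModule) (K * B ^ 3)%R (fun n => p ^ n)%R).
    apply ex_series_geom. rewrite Rabs_pos_eq; lra. }
  intros n i Hi. specialize (HK i (n - i)%nat). specialize (HB n).
  replace (i + (n - i))%nat with n in HK by lia.
  pose proof (pow_lt p n (proj1 Hp)) as Hq. pose proof (Cmod_ge_0 (c i (n - i)%nat)) as H0.
  assert (E8 : ((((p ^ 2) ^ 2) ^ 2) ^ n = (p ^ n) ^ 8)%R)
    by (rewrite <- !pow_mult; f_equal; lia).
  assert (E4 : (((p ^ 2) ^ 2) ^ n = (p ^ n) ^ 4)%R) by (rewrite <- !pow_mult; f_equal; lia).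
  rewrite E8. rewrite E4 in HK.
  set (q := (p ^ n)%R) in *. set (a := Cmod (c i (n - i)%nat)) in *. set (m := (INR n + 1)%R) in *.
  assert (Hm : (0 <= m)%R) by (unfold m; pose proof (pos_INR n); lra).
  replace (m ^ 3 * (a * q ^ 8))%R with ((a * q ^ 4) * (m * q) ^ 3 * q)%R by ring.
  apply Rmult_le_compat_r; [lra|].
  assert (Hmq : (0 <= m * q)%R) by (apply Rmult_le_pos; lra).
  apply Rmult_le_compat.
  - apply Rmult_le_pos; [exact H0|]. apply pow_le; lra.
  - now apply pow_le.
  - exact HK.
  - apply pow_incr; split; assumption.
Qed.

Lemma Cpow_S (x : C) (n : nat) : x ^ S n = x * x ^ n.
Proof. reflexivity. Qed.

Lemma Cmod_Cpow_le (x : C) (r : R) (n : nat) : (Cmod x <= r)%R -> (Cmod (x ^ n) <= r ^ n)%R.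
Proof.
  intros H. rewrite Cmod_pow. apply pow_incr. split; [apply Cmod_ge_0|exact H].
Qed.

(** The derivative of x^n; at n = 0 the truncated exponent is harmless because the factor in front
    is 0. *)
Definition dpow (n : nat) (x : C) : C := RtoC (INR n) * x ^ pred n.

Lemma dpow_mult (n : nat) (x : C) : dpow n x * x = RtoC (INR n) * x ^ n.
Proof. unfold dpow. destruct n; simpl; ring. Qed.

(** The extra r on the left keeps the exponent n - 1 from appearing; the Lipschitz and Taylor bounds
    below are scaled in the same way. *)
Lemma Cmod_dpow_le (n : nat) (x : C) (r : R) : (Cmod x <= r)%R ->
  (r * Cmod (dpow n x) <= INR n * r ^ n)%R.
Proof.
  intros H. unfold dpow. rewrite Cmod_mult, Cmod_INR. destruct n as [|n].
  - simpl. lra.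
  - pose proof (Cmod_Cpow_le x r n H) as Hp. pose proof (Cmod_ge_0 x).
    pose proof (pos_INR (S n)). simpl pred. simpl pow.
    replace (r * (INR (S n) * Cmod (x ^ n)))%R with ((r * INR (S n)) * Cmod (x ^ n))%R by ring.
    replace (INR (S n) * (r * r ^ n))%R with ((r * INR (S n)) * r ^ n)%R by ring.
    apply Rmult_le_compat_l; [apply Rmult_le_pos; lra|exact Hp].
Qed.

Lemma Cpow_lipschitz (x y : C) (r : R) (n : nat) : (Cmod x <= r)%R -> (Cmod y <= r)%R ->
  (r * Cmod (x ^ n - y ^ n) <= INR n * r ^ n * Cmod (x - y))%R.
Proof.
  intros Hx Hy. pose proof (Cmod_ge_0 x) as Hx0. pose proof (Cmod_ge_0 (x - y)) as Hu.
  induction n as [|n IH].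
  - simpl. replace (1 - 1)%C with (RtoC 0) by ring. rewrite Cmod_0. lra.
  - replace (x ^ S n - y ^ S n) with (x * (x ^ n - y ^ n) + (x - y) * y ^ n)
      by (rewrite !Cpow_S; ring).
    pose proof (Cmod_Cpow_le y r n Hy) as Hp.
    eapply Rle_trans; [apply Rmult_le_compat_l; [lra|apply Cmod_triangle]|].
    rewrite !Cmod_mult, S_INR. simpl pow.
    pose proof (Cmod_ge_0 (x ^ n - y ^ n)) as Hd.
    assert (H1 : (Cmod x * (r * Cmod (x ^ n - y ^ n)) <= r * (INR n * r ^ n * Cmod (x - y)))%R).
    { apply Rmult_le_compat; try assumption. apply Rmult_le_pos; lra. }
    assert (H2 : ((r * Cmod (x - y)) * Cmod (y ^ n) <= (r * Cmod (x - y)) * r ^ n)%R).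
    { apply Rmult_le_compat_l; [apply Rmult_le_pos; lra|exact Hp]. }
    lra.
Qed.

(** The remainders satisfy R_(n+1) = x R_n + (x - y)^2 n y^(n-1), and n^2 + n <= (n + 1)^2 closes
    the induction. *)
Lemma Cpow_taylor (x y : C) (r : R) (n : nat) : (Cmod x <= r)%R -> (Cmod y <= r)%R ->
  (r ^ 2 * Cmod (x ^ n - y ^ n - (x - y) * dpow n y)
     <= INR n ^ 2 * r ^ n * Cmod (x - y) ^ 2)%R.
Proof.
  intros Hx Hy. pose proof (Cmod_ge_0 x) as Hx0. pose proof (Cmod_ge_0 (x - y)) as Hu.
  induction n as [|n IH].
  - unfold dpow. simpl. replace (1 - 1 - (x - y) * (0 * 1))%C with (RtoC 0) by ring.
    rewrite Cmod_0. lra.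
  - replace (x ^ S n - y ^ S n - (x - y) * dpow (S n) y)
      with (x * (x ^ n - y ^ n - (x - y) * dpow n y) + (x - y) * (x - y) * dpow n y).
    2:{ assert (E := dpow_mult n y). set (d := dpow n y) in *.
        unfold dpow. simpl pred. rewrite !Cpow_S, S_INR, RtoC_plus.
        transitivity (x * x ^ n - y * y ^ n - (x - y) * (d * y + y ^ n)); [ring|].
        rewrite E. ring. }
    pose proof (Cmod_dpow_le n y r Hy) as Hp.
    eapply Rle_trans; [apply Rmult_le_compat_l; [apply pow_le; lra|apply Cmod_triangle]|].
    rewrite !Cmod_mult, S_INR.
    set (e := Cmod (x ^ n - y ^ n - (x - y) * dpow n y)) in *.
    assert (He : (0 <= e)%R) by apply Cmod_ge_0.
    assert (Hrn : (0 <= r ^ n)%R) by (apply pow_le; lra).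
    assert (H1 : (Cmod x * (r ^ 2 * e) <= r * (INR n ^ 2 * r ^ n * Cmod (x - y) ^ 2))%R).
    { apply Rmult_le_compat; try assumption. apply Rmult_le_pos; [apply pow_le; lra|exact He]. }
    assert (H2 : ((r * Cmod (x - y) ^ 2) * (r * Cmod (dpow n y))
                   <= (r * Cmod (x - y) ^ 2) * (INR n * r ^ n))%R).
    { apply Rmult_le_compat_l; [|exact Hp]. apply Rmult_le_pos; [lra|apply pow_le; lra]. }
    pose proof (pos_INR n) as Hn.
    assert (H3 : (0 <= r * r ^ n * Cmod (x - y) ^ 2 * (INR n + 1))%R).
    { repeat apply Rmult_le_pos; try lra. }
    simpl pow in *. nra.
Qed.

(** The remainder splits into the Taylor remainder in x, the one in y, and a product of two
    first-order increments. Their constants i^2, j^2 and i j are all dominated by (i + j)^2. *)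
Lemma monomial_taylor (x y x0 y0 : C) (r : R) (i j : nat) :
  (Cmod x <= r)%R -> (Cmod y <= r)%R -> (Cmod x0 <= r)%R -> (Cmod y0 <= r)%R ->
  (r ^ 2 * Cmod (x ^ i * y ^ j - x0 ^ i * y0 ^ j
       - (x - x0) * (dpow i x0 * y0 ^ j) - (y - y0) * (x0 ^ i * dpow j y0))
     <= INR (i + j) ^ 2 * r ^ (i + j) * (Cmod (x - x0) + Cmod (y - y0)) ^ 2)%R.
Proof.
  intros Hx Hy Hx0 Hy0.
  pose proof (Cpow_taylor x x0 r i Hx Hx0) as H1.
  pose proof (Cpow_taylor y y0 r j Hy Hy0) as H2.
  pose proof (Cpow_lipschitz y y0 r j Hy Hy0) as H3.
  pose proof (Cmod_dpow_le i x0 r Hx0) as H4.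
  pose proof (Cmod_Cpow_le y r j Hy) as H5.
  pose proof (Cmod_Cpow_le x0 r i Hx0) as H6.
  pose proof (Cmod_ge_0 x) as Hr.
  set (u := x - x0) in *. set (v := y - y0) in *.
  set (E := x ^ i - x0 ^ i - u * dpow i x0) in *.
  set (F := y ^ j - y0 ^ j - v * dpow j y0) in *.
  set (D := y ^ j - y0 ^ j) in *.
  replace (x ^ i * y ^ j - x0 ^ i * y0 ^ j - u * (dpow i x0 * y0 ^ j) - v * (x0 ^ i * dpow j y0))
    with (E * y ^ j + x0 ^ i * F + u * (dpow i x0 * D)) by (unfold E, F, D; ring).
  pose proof (Cmod_triangle (E * y ^ j + x0 ^ i * F) (u * (dpow i x0 * D))) as T1.
  pose proof (Cmod_triangle (E * y ^ j) (x0 ^ i * F)) as T2.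
  rewrite !Cmod_mult in T1, T2.
  pose proof (Cmod_ge_0 E). pose proof (Cmod_ge_0 F). pose proof (Cmod_ge_0 D).
  pose proof (Cmod_ge_0 u). pose proof (Cmod_ge_0 v). pose proof (Cmod_ge_0 (dpow i x0)).
  assert (Hri : (0 <= r ^ i)%R) by (apply pow_le; lra).
  assert (Hrj : (0 <= r ^ j)%R) by (apply pow_le; lra).
  pose proof (pos_INR i). pose proof (pos_INR j).
  assert (r2 : (0 <= r ^ 2)%R) by (apply pow_le; lra).
  assert (A1 : ((r ^ 2 * Cmod E) * Cmod (y ^ j) <= (INR i ^ 2 * r ^ i * Cmod u ^ 2) * r ^ j)%R).
  { apply Rmult_le_compat; try assumption; [now apply Rmult_le_pos|apply Cmod_ge_0]. }
  assert (A2 : (Cmod (x0 ^ i) * (r ^ 2 * Cmod F) <= r ^ i * (INR j ^ 2 * r ^ j * Cmod v ^ 2))%R).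
  { apply Rmult_le_compat; try assumption; [apply Cmod_ge_0|now apply Rmult_le_pos]. }
  assert (A3 : ((r * Cmod (dpow i x0)) * (r * Cmod D) <= (INR i * r ^ i) * (INR j * r ^ j * Cmod v))%R).
  { apply Rmult_le_compat; try assumption; apply Rmult_le_pos; lra. }
  assert (A4 := Rmult_le_compat_l (Cmod u) _ _ ltac:(assumption) A3).
  rewrite plus_INR, pow_add.
  apply Rle_trans with (r ^ 2 * (Cmod E * Cmod (y ^ j) + Cmod (x0 ^ i) * Cmod F
                          + Cmod u * (Cmod (dpow i x0) * Cmod D)))%R.
  { apply Rmult_le_compat_l; [exact r2|lra]. }
  apply Rle_trans with ((r ^ i * r ^ j) *
    (INR i ^ 2 * Cmod u ^ 2 + INR j ^ 2 * Cmod v ^ 2 + INR i * INR j * (Cmod u * Cmod v)))%R.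
  { clear - A1 A2 A4. simpl pow in *. lra. }
  assert (Hq : (0 <= r ^ i * r ^ j)%R) by now apply Rmult_le_pos.
  replace ((INR i + INR j) ^ 2 * (r ^ i * r ^ j) * (Cmod u + Cmod v) ^ 2)%R
    with ((r ^ i * r ^ j) * ((INR i + INR j) ^ 2 * (Cmod u + Cmod v) ^ 2))%R by ring.
  apply Rmult_le_compat_l; [exact Hq|].
  set (a := INR i) in *. set (b := INR j) in *. set (U := Cmod u) in *. set (V := Cmod v) in *.
  assert (0 <= a * b)%R by now apply Rmult_le_pos.
  assert (0 <= U * V)%R by now apply Rmult_le_pos.
  assert (0 <= (a * a + b * b) * (U * V))%R by (apply Rmult_le_pos; nra).
  assert (0 <= (a * b) * (U * U + V * V))%R by (apply Rmult_le_pos; nra).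
  assert (0 <= a * a * (V * V))%R by (apply Rmult_le_pos; nra).
  assert (0 <= b * b * (U * U))%R by (apply Rmult_le_pos; nra).
  assert (0 <= (a * b) * (U * V))%R by now apply Rmult_le_pos.
  nra.
Qed.

(** Grouping by total degree turns the double series into a single one. *)
Definition hterm (c : nat -> nat -> C) (x y : C) (n : nat) : C :=
  sum_n (fun i => c i (n - i)%nat * (x ^ i * y ^ (n - i))) n.

Definition PS2 (c : nat -> nat -> C) (x y : C) : C := CSeries (hterm c x y).

Lemma INR_ge_1 (n : nat) : (1 <= INR n + 1)%R.
Proof. pose proof (pos_INR n). lra. Qed.

Lemma hterm_summable (c : nat -> nat -> C) (x y : C) (r : R) : bidisc_coef c ->
  (0 < r < 1)%R -> (Cmod x <= r)%R -> (Cmod y <= r)%R -> summable (hterm c x y).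
Proof.
  intros Hc Hr Hx Hy. destruct (bidisc_coef_majorant c r Hc Hr) as [M [HM H]].
  apply (summable_le _ M); [|exact HM]. intros n. pose proof (INR_ge_1 n) as Hn.
  eapply Rle_trans; [apply (Cmod_sum_n_le _ (M n / (INR n + 1) ^ 3))|].
  - intros i Hi. apply Rmult_le_reg_l with ((INR n + 1) ^ 3)%R; [apply pow_lt; lra|].
    replace ((INR n + 1) ^ 3 * (M n / (INR n + 1) ^ 3))%R with (M n) by (field; lra).
    eapply Rle_trans; [|apply (H n i Hi)]. apply Rmult_le_compat_l; [apply pow_le; lra|].
    rewrite !Cmod_mult. apply Rmult_le_compat_l; [apply Cmod_ge_0|].
    replace (r ^ n)%R with (r ^ i * r ^ (n - i))%R by (rewrite <- pow_add; f_equal; lia).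
    apply Rmult_le_compat; try apply Cmod_ge_0; now apply Cmod_Cpow_le.
  - assert (HM0 : (0 <= M n)%R).
    { eapply Rle_trans; [|apply (H n n (le_n n))].
      apply Rmult_le_pos; [apply pow_le; lra|]. apply Rmult_le_pos; [apply Cmod_ge_0|].
      apply pow_le; lra. }
    replace ((INR n + 1) * (M n / (INR n + 1) ^ 3))%R with (M n / (INR n + 1) ^ 2)%R
      by (field; lra).
    apply Rmult_le_reg_r with ((INR n + 1) ^ 2)%R; [apply pow_lt; lra|].
    replace (M n / (INR n + 1) ^ 2 * (INR n + 1) ^ 2)%R with (M n) by (field; lra).
    assert (1 <= (INR n + 1) ^ 2)%R by (simpl; nra). nra.
Qed.

Lemma hterm_dx (c : nat -> nat -> C) (x y : C) (n : nat) :
  sum_n (fun i => c i (S n - i)%nat * (dpow i x * y ^ (S n - i))) (S n) = hterm (dx c) x y n.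
Proof.
  rewrite Csum_head. unfold dpow at 1. simpl INR.
  replace (c 0%nat (S n - 0)%nat * (0 * x ^ pred 0 * y ^ (S n - 0))) with (RtoC 0) by ring.
  rewrite Cplus_0_l. apply Csum_ext. intros i Hi. unfold dx, dpow. simpl pred.
  replace (S n - S i)%nat with (n - i)%nat by lia. ring.
Qed.

Lemma hterm_dy (c : nat -> nat -> C) (x y : C) (n : nat) :
  sum_n (fun i => c i (S n - i)%nat * (x ^ i * dpow (S n - i) y)) (S n) = hterm (dy c) x y n.
Proof.
  rewrite Csum_S. unfold dpow at 2. rewrite Nat.sub_diag. simpl INR.
  replace (c (S n) 0%nat * (x ^ S n * (0 * y ^ pred 0))) with (RtoC 0) by ring.
  rewrite Cplus_0_r. apply Csum_ext. intros i Hi. unfold dy, dpow.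
  replace (S n - i)%nat with (S (n - i)) by lia. simpl pred. ring.
Qed.

Lemma summable_incr (u : nat -> C) : summable (fun n => u (S n)) -> summable u.
Proof. intros H. now apply (ex_series_incr_1 (fun n => Cmod (u n))). Qed.

(** The monomial estimate is summed against the majorant, which does not depend on the points; hence
    K is uniform on the closed bidisc of radius r. *)
Lemma PS2_taylor (c : nat -> nat -> C) (r : R) : bidisc_coef c -> (0 < r < 1)%R ->
  exists K : R, forall x y x0 y0 : C,
    (Cmod x <= r)%R -> (Cmod y <= r)%R -> (Cmod x0 <= r)%R -> (Cmod y0 <= r)%R ->
    (Cmod (PS2 c x y - PS2 c x0 y0 - (x - x0) * PS2 (dx c) x0 y0 - (y - y0) * PS2 (dy c) x0 y0)
      <= K * (Cmod (x - x0) + Cmod (y - y0)) ^ 2)%R.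
Proof.
  intros Hc Hr. destruct (bidisc_coef_majorant c r Hc Hr) as [M [HM H]].
  exists (2 * (Series M / r ^ 2))%R. intros x y x0 y0 Hx Hy Hx0 Hy0.
  (* [d] and [e] are the termwise derivatives before the degree drops by one. Their term of index 0
     vanishes, and they line up with [hterm c] degree by degree. *)
  pose (d := fun n => sum_n (fun i => c i (n - i)%nat * (dpow i x0 * y0 ^ (n - i))) n).
  pose (e := fun n => sum_n (fun i => c i (n - i)%nat * (x0 ^ i * dpow (n - i) y0)) n).
  assert (Sd : summable d).
  { apply summable_incr. apply (summable_le _ (fun n => Cmod (hterm (dx c) x0 y0 n))).
    - intros n. unfold d. rewrite hterm_dx. apply Rle_refl.
    - apply (hterm_summable _ _ _ r); auto. now apply bidisc_coef_dx. }
  assert (Se : summable e).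
  { apply summable_incr. apply (summable_le _ (fun n => Cmod (hterm (dy c) x0 y0 n))).
    - intros n. unfold e. rewrite hterm_dy. apply Rle_refl.
    - apply (hterm_summable _ _ _ r); auto. now apply bidisc_coef_dy. }
  assert (Ed : PS2 (dx c) x0 y0 = CSeries d).
  { rewrite (CSeries_head d Sd). unfold d at 1. rewrite Csum_O. unfold dpow. simpl.
    replace (c 0%nat 0%nat * (0 * 1 * 1)) with (RtoC 0) by ring. rewrite Cplus_0_l.
    apply CSeries_ext. intros n. symmetry. apply hterm_dx. }
  assert (Ee : PS2 (dy c) x0 y0 = CSeries e).
  { rewrite (CSeries_head e Se). unfold e at 1. rewrite Csum_O. unfold dpow. simpl.
    replace (c 0%nat 0%nat * (1 * (0 * 1))) with (RtoC 0) by ring. rewrite Cplus_0_l.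
    apply CSeries_ext. intros n. symmetry. apply hterm_dy. }
  assert (S1 := hterm_summable c x y r Hc Hr Hx Hy).
  assert (S0 := hterm_summable c x0 y0 r Hc Hr Hx0 Hy0).
  assert (S2 := summable_scal (-(1)) _ S0).
  assert (S3 := summable_scal (- (x - x0)) _ Sd).
  assert (S4 := summable_scal (- (y - y0)) _ Se).
  assert (E : PS2 c x y - PS2 c x0 y0 - (x - x0) * PS2 (dx c) x0 y0 - (y - y0) * PS2 (dy c) x0 y0
    = CSeries (fun n => (hterm c x y n + - (1) * hterm c x0 y0 n)
        + (- (x - x0) * d n + - (y - y0) * e n))).
  { rewrite CSeries_plus by now apply summable_plus.
    rewrite CSeries_plus by assumption. rewrite CSeries_plus by assumption.
    rewrite !CSeries_scal by assumption. rewrite Ed, Ee. unfold PS2. ring. }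
  rewrite E. set (W := ((Cmod (x - x0) + Cmod (y - y0)) ^ 2)%R).
  assert (HW : (0 <= W)%R) by apply pow2_ge_0.
  replace (2 * (Series M / r ^ 2) * W)%R with (2 * (W / r ^ 2 * Series M))%R by (field; lra).
  rewrite <- Series_scal_l. apply Cmod_CSeries_le.
  2: exact (ex_series_scal (K := R_AbsRing) (V := R_NormedModule) (W / r ^ 2)%R M HM).
  intros n. unfold hterm, d, e. rewrite <- !Csum_scal, <- !Csum_plus.
  pose proof (INR_ge_1 n) as Hn.
  (* Each of the n + 1 monomials of degree n receives an equal share of [M n]. *)
  eapply Rle_trans; [apply (Cmod_sum_n_le _ (W / r ^ 2 * (M n / (INR n + 1))))|].
  2: { right. field. lra. }
  intros i Hi.
  replace (c i (n - i)%nat * (x ^ i * y ^ (n - i))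
      + - (1) * (c i (n - i)%nat * (x0 ^ i * y0 ^ (n - i)))
      + (- (x - x0) * (c i (n - i)%nat * (dpow i x0 * y0 ^ (n - i)))
         + - (y - y0) * (c i (n - i)%nat * (x0 ^ i * dpow (n - i) y0))))
    with (c i (n - i)%nat * (x ^ i * y ^ (n - i) - x0 ^ i * y0 ^ (n - i)
       - (x - x0) * (dpow i x0 * y0 ^ (n - i)) - (y - y0) * (x0 ^ i * dpow (n - i) y0))) by ring.
  rewrite Cmod_mult.
  pose proof (monomial_taylor x y x0 y0 r i (n - i) Hx Hy Hx0 Hy0) as T.
  replace (i + (n - i))%nat with n in T by lia. fold W in T.
  set (m := Cmod (x ^ i * y ^ (n - i) - x0 ^ i * y0 ^ (n - i)
       - (x - x0) * (dpow i x0 * y0 ^ (n - i)) - (y - y0) * (x0 ^ i * dpow (n - i) y0))) in *.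
  specialize (H n i Hi). set (a := Cmod (c i (n - i)%nat)) in *.
  assert (Ha : (0 <= a)%R) by apply Cmod_ge_0.
  assert (Hr2 : (0 < r ^ 2)%R) by (apply pow_lt; lra).
  assert (Hrn : (0 < r ^ n)%R) by (apply pow_lt; lra).
  apply Rmult_le_reg_l with (r ^ 2 * (INR n + 1))%R; [apply Rmult_lt_0_compat; lra|].
  replace (r ^ 2 * (INR n + 1) * (W / r ^ 2 * (M n / (INR n + 1))))%R with (W * M n)%R
    by (field; lra).
  apply Rle_trans with (W * ((INR n + 1) ^ 3 * (a * r ^ n)))%R.
  2: now apply Rmult_le_compat_l.
  apply Rle_trans with (a * (INR n + 1) * (INR n ^ 2 * r ^ n * W))%R.
  - replace (r ^ 2 * (INR n + 1) * (a * m))%R with (a * (INR n + 1) * (r ^ 2 * m))%R by ring.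
    apply Rmult_le_compat_l; [|exact T]. apply Rmult_le_pos; lra.
  - replace (a * (INR n + 1) * (INR n ^ 2 * r ^ n * W))%R
      with ((a * r ^ n * W * (INR n + 1)) * INR n ^ 2)%R by ring.
    replace (W * ((INR n + 1) ^ 3 * (a * r ^ n)))%R
      with ((a * r ^ n * W * (INR n + 1)) * (INR n + 1) ^ 2)%R by ring.
    apply Rmult_le_compat_l.
    + apply Rmult_le_pos; [apply Rmult_le_pos; [apply Rmult_le_pos|]|]; lra.
    + apply pow_incr. lra.
Qed.

(** * The complex exponential and differentiability in two variables *)

Lemma Cexp_plus (z w : C) : Cexp (z + w) = Cexp z * Cexp w.
Proof.
  unfold Cexp, Cmult, Re, Im; simpl. rewrite exp_plus, cos_plus, sin_plus. f_equal; ring.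
Qed.

Lemma Cexp_0 : Cexp 0 = 1.
Proof. unfold Cexp; simpl. rewrite exp_0, cos_0, sin_0. unfold RtoC. f_equal; ring. Qed.

Lemma Cexp_neq_0 (z : C) : Cexp z <> 0.
Proof.
  intros H. assert (E : Cexp z * Cexp (- z) = 1).
  { rewrite <- Cexp_plus. replace (z + - z) with (RtoC 0) by ring. apply Cexp_0. }
  rewrite H, Cmult_0_l in E. injection E. lra.
Qed.

Lemma derivable_eps (f : R -> R) (l : R) : is_derive f 0%R l ->
  forall eps : R, (0 < eps)%R -> exists d : R, (0 < d)%R /\
    forall h : R, (Rabs h < d)%R -> (Rabs (f h - f 0 - h * l) <= eps * Rabs h)%R.
Proof.
  intros [_ H] eps He. destruct (H 0%R (fun P HP => HP) (mkposreal eps He)) as [d Hd].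
  exists d; split; [apply cond_pos|]. intros h Hh.
  specialize (Hd h). unfold norm, minus, plus, opp, scal, ball in Hd; simpl in Hd.
  unfold AbsRing_ball, abs, minus, plus, opp, mult in Hd; simpl in Hd.
  unfold mult in Hd; simpl in Hd.
  replace (h + - 0)%R with h in Hd by ring. apply Hd, Hh.
Qed.

Lemma Cmod_le_Re_Im (z : C) : (Cmod z <= Rabs (Re z) + Rabs (Im z))%R.
Proof.
  pose proof (Rabs_pos (Re z)). pose proof (Rabs_pos (Im z)).
  unfold Cmod. rewrite <- (sqrt_pow2 (Rabs (Re z) + Rabs (Im z))) by lra.
  apply sqrt_le_1_alt. rewrite <- (pow2_abs (fst z)), <- (pow2_abs (snd z)).
  unfold Re, Im in *. nra.
Qed.

Lemma cderive_Cexp_0 : cderive Cexp 0 1.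
Proof.
  apply cderive_eps. intros eps He.
  (* The components of the remainder are at most 4 e m and 5 e m below, where m = |t|, and 9 e <=
     eps. The cap 1 keeps the cofactors such as 1 + x and 1 + B bounded. *)
  set (e := Rmin (eps / 10) 1).
  assert (He0 : (0 < e)%R) by (apply Rmin_glb_lt; lra).
  assert (He1 : (e <= eps / 10)%R) by apply Rmin_l.
  assert (He2 : (e <= 1)%R) by apply Rmin_r.
  clearbody e.
  assert (D1 : is_derive exp 0%R 1%R).
  { replace 1%R with (exp 0) by apply exp_0. apply is_derive_exp. }
  assert (D2 : is_derive cos 0%R 0%R).
  { replace 0%R with (- sin 0)%R at 2 by (rewrite sin_0; ring). apply is_derive_cos. }
  assert (D3 : is_derive sin 0%R 1%R).
  { replace 1%R with (cos 0) by apply cos_0. apply is_derive_sin. }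
  destruct (derivable_eps _ _ D1 e He0) as [d1 [P1 H1]].
  destruct (derivable_eps _ _ D2 e He0) as [d2 [P2 H2]].
  destruct (derivable_eps _ _ D3 e He0) as [d3 [P3 H3]].
  rewrite exp_0 in H1. rewrite cos_0 in H2. rewrite sin_0 in H3.
  exists (Rmin (Rmin d1 d2) (Rmin d3 e)). split; [repeat apply Rmin_glb_lt; assumption|].
  intros t Ht. replace (t - 0) with t in * by ring.
  pose proof (Rmin_l (Rmin d1 d2) (Rmin d3 e)). pose proof (Rmin_r (Rmin d1 d2) (Rmin d3 e)).
  pose proof (Rmin_l d1 d2). pose proof (Rmin_r d1 d2).
  pose proof (Rmin_l d3 e). pose proof (Rmin_r d3 e).
  pose proof (Rabs_Re_le t) as Hx. pose proof (Rabs_Im_le t) as Hy.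
  destruct t as [x y]. unfold Re, Im in Hx, Hy; simpl in Hx, Hy.
  set (m := Cmod (x, y)) in *.
  specialize (H1 x ltac:(lra)). specialize (H2 y ltac:(lra)). specialize (H3 y ltac:(lra)).
  set (A := (exp x - 1 - x * 1)%R) in *. set (B := (cos y - 1 - y * 0)%R) in *.
  set (S := (sin y - 0 - y * 1)%R) in *.
  rewrite Cexp_0.
  (* Expansion of (1 + x + A)(1 + B) and (1 + x + A)(y + S), where A, B, S are the remainders of
     exp, cos and sin. *)
  replace (Cexp (x, y) - 1 - (x, y) * 1)
    with ((A * (1 + B) + (1 + x) * B)%R, ((1 + x + A) * S + (x + A) * y)%R).
  2:{ unfold Cexp, Cminus, Cplus, Copp, Cmult, RtoC, A, B, S, Re, Im; simpl. f_equal; ring. }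
  eapply Rle_trans; [apply Cmod_le_Re_Im|]. unfold Re, Im; simpl.
  assert (m0 : (0 <= m)%R) by apply Cmod_ge_0.
  assert (A1 : (Rabs A <= e * m)%R) by (eapply Rle_trans; [exact H1|apply Rmult_le_compat_l; lra]).
  assert (B1 : (Rabs B <= e * m)%R) by (eapply Rle_trans; [exact H2|apply Rmult_le_compat_l; lra]).
  assert (S1 : (Rabs S <= e * m)%R) by (eapply Rle_trans; [exact H3|apply Rmult_le_compat_l; lra]).
  assert (em : (e * m <= e)%R) by nra.
  assert (X1 : (Rabs (1 + x) <= 2)%R).
  { eapply Rle_trans; [apply Rabs_triang|]. rewrite Rabs_R1. lra. }
  assert (X2 : (Rabs (1 + B) <= 2)%R).
  { eapply Rle_trans; [apply Rabs_triang|]. rewrite Rabs_R1. lra. }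
  assert (X3 : (Rabs (1 + x + A) <= 3)%R).
  { eapply Rle_trans; [apply Rabs_triang|]. lra. }
  assert (X4 : (Rabs (x + A) <= 2 * e)%R).
  { eapply Rle_trans; [apply Rabs_triang|]. lra. }
  assert (Y1 : (Rabs (A * (1 + B) + (1 + x) * B) <= 4 * (e * m))%R).
  { eapply Rle_trans; [apply Rabs_triang|]. rewrite !Rabs_mult.
    pose proof (Rabs_pos A). pose proof (Rabs_pos B).
    pose proof (Rabs_pos (1 + B)). pose proof (Rabs_pos (1 + x)). nra. }
  assert (Y2 : (Rabs ((1 + x + A) * S + (x + A) * y) <= 5 * (e * m))%R).
  { eapply Rle_trans; [apply Rabs_triang|]. rewrite !Rabs_mult.
    pose proof (Rabs_pos S). pose proof (Rabs_pos y).
    pose proof (Rabs_pos (1 + x + A)). pose proof (Rabs_pos (x + A)). nra. }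
  nra.
Qed.

Lemma cderive_shift (f : C -> C) (z a l : C) :
  cderive f (z - a) l -> cderive (fun t => f (t - a)) z l.
Proof.
  intros H. apply (cderive_eq _ _ ((1 + 0) * l)); [ring|].
  apply (cderive_comp f (fun t => t - a)); [exact H|].
  apply (cderive_plus (fun t => t) (fun _ => - a)); [apply cderive_id|apply cderive_const].
Qed.

Lemma cderive_Cexp (z : C) : cderive Cexp z (Cexp z).
Proof.
  apply (cderive_ext
           (fun t => Cexp z * Cexp (t - z))).
  - intros t. rewrite <- Cexp_plus. f_equal. ring.
  - apply (cderive_eq _ _ (Cexp z * 1)); [ring|].
    apply (cderive_scal (Cexp z) (fun t => Cexp (t - z))). apply cderive_shift.
    replace (z - z) with (RtoC 0) by ring. apply cderive_Cexp_0.
Qed.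

Definition diff2_at (F : C -> C -> C) (p q A B : C) : Prop :=
  forall eps : R, (0 < eps)%R -> exists d : R, (0 < d)%R /\
    forall u v : C, (Cmod (u - p) < d)%R -> (Cmod (v - q) < d)%R ->
      (Cmod (F u v - F p q - (u - p) * A - (v - q) * B)
         <= eps * (Cmod (u - p) + Cmod (v - q)))%R.

Lemma cderive_lipschitz (f : C -> C) (z l : C) : cderive f z l ->
  exists d : R, (0 < d)%R /\ forall t : C, (Cmod (t - z) < d)%R ->
    (Cmod (f t - f z) <= (Cmod l + 1) * Cmod (t - z))%R.
Proof.
  intros H. apply cderive_eps with (eps := 1%R) in H; [|lra]. destruct H as [d [Hd H]].
  exists d; split; [exact Hd|]. intros t Ht. specialize (H t Ht).
  replace (f t - f z) with ((f t - f z - (t - z) * l) + (t - z) * l) by ring.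
  eapply Rle_trans; [apply Cmod_triangle|]. rewrite Cmod_mult. lra.
Qed.

(** Along the curves F is a constant plus A x + B y plus the remainder [Rm], so only the vanishing
    of the derivative of [Rm] needs an estimate. *)
Lemma diff2_at_chain (F : C -> C -> C) (A B : C) (x y : C -> C) (s a b : C) :
  diff2_at F (x s) (y s) A B -> cderive x s a -> cderive y s b ->
  cderive (fun t => F (x t) (y t)) s (a * A + b * B).
Proof.
  intros HF Hx Hy.
  pose (Rm := fun t => F (x t) (y t) - F (x s) (y s) - (x t - x s) * A - (y t - y s) * B).
  assert (HR : cderive Rm s 0).
  { apply cderive_eps. intros eps He.
    destruct (cderive_lipschitz x s a Hx) as [d1 [P1 H1]].
    destruct (cderive_lipschitz y s b Hy) as [d2 [P2 H2]].
    pose proof (Cmod_ge_0 a) as Ha. pose proof (Cmod_ge_0 b) as Hb.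
    (* L is a joint Lipschitz constant at s: the increments of x and y together are at most L |t -
       s|. *)
    set (L := (Cmod a + 1 + (Cmod b + 1))%R). assert (HL : (0 < L)%R) by (unfold L; lra).
    destruct (HF (eps / L)%R (Rdiv_lt_0_compat _ _ He HL)) as [d3 [P3 H3]].
    assert (P4 := Rdiv_lt_0_compat _ _ P3 HL).
    exists (Rmin (Rmin d1 d2) (d3 / L)). split; [repeat apply Rmin_glb_lt; assumption|].
    intros t Ht. pose proof (Rmin_l (Rmin d1 d2) (d3 / L)). pose proof (Rmin_r (Rmin d1 d2) (d3 / L)).
    pose proof (Rmin_l d1 d2). pose proof (Rmin_r d1 d2).
    specialize (H1 t ltac:(lra)). specialize (H2 t ltac:(lra)).
    pose proof (Cmod_ge_0 (t - s)) as Hh.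
    assert (Hd3 : (L * Cmod (t - s) < d3)%R).
    { apply Rmult_lt_reg_r with (/ L)%R; [now apply Rinv_0_lt_compat|].
      replace (L * Cmod (t - s) * / L)%R with (Cmod (t - s)) by (field; lra). unfold Rdiv in *. lra. }
    assert (L1 : (0 <= Cmod a * Cmod (t - s))%R) by now apply Rmult_le_pos.
    assert (L2 : (0 <= Cmod b * Cmod (t - s))%R) by now apply Rmult_le_pos.
    assert (K1 : (Cmod (x t - x s) < d3)%R) by (unfold L in Hd3; lra).
    assert (K2 : (Cmod (y t - y s) < d3)%R) by (unfold L in Hd3; lra).
    specialize (H3 _ _ K1 K2).
    replace (Rm t - Rm s - (t - s) * 0) with (Rm t) by (unfold Rm; ring).
    eapply Rle_trans; [exact H3|].
    apply Rle_trans with (eps / L * (L * Cmod (t - s)))%R.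
    - apply Rmult_le_compat_l; [apply Rlt_le, Rdiv_lt_0_compat; assumption|]. unfold L; lra.
    - right. field. lra. }
  apply (cderive_ext
    (fun t => (F (x s) (y s) - x s * A - y s * B) + (A * x t + (B * y t + Rm t)))).
  { intros t. unfold Rm. ring. }
  apply (cderive_eq _ _ (0 + (A * a + (B * b + 0)))); [ring|].
  apply (cderive_plus (fun _ => F (x s) (y s) - x s * A - y s * B)); [apply cderive_const|].
  apply (cderive_plus (fun t => A * x t)); [now apply cderive_scal|].
  apply (cderive_plus (fun t => B * y t)); [now apply cderive_scal|exact HR].
Qed.

Lemma PS2_diff2 (c : nat -> nat -> C) (p q : C) : bidisc_coef c ->
  (Cmod p < 1)%R -> (Cmod q < 1)%R ->
  diff2_at (PS2 c) p q (PS2 (dx c) p q) (PS2 (dy c) p q).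
Proof.
  intros Hc Hp Hq. pose proof (Cmod_ge_0 p). pose proof (Cmod_ge_0 q).
  set (m := Rmax (Cmod p) (Cmod q)).
  assert (Hm : (m < 1)%R) by now apply Rmax_lub_lt.
  pose proof (Rmax_l (Cmod p) (Cmod q)) as M1. pose proof (Rmax_r (Cmod p) (Cmod q)) as M2.
  fold m in M1, M2. set (r := ((m + 1) / 2)%R).
  assert (Hr : (0 < r < 1)%R) by (unfold r; lra).
  assert (Hmr : (m < r)%R) by (unfold r; lra).
  destruct (PS2_taylor c r Hc Hr) as [K HK].
  intros eps He. pose proof (Rabs_pos K) as K0. pose proof (Rle_abs K) as K1.
  assert (K2 : (0 < 2 * (Rabs K + 1))%R) by lra.
  exists (Rmin (r - m) (eps / (2 * (Rabs K + 1)))). split.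
  { apply Rmin_glb_lt; [unfold r; lra|]. now apply Rdiv_lt_0_compat. }
  intros u v Hu Hv. pose proof (Rmin_l (r - m) (eps / (2 * (Rabs K + 1)))).
  pose proof (Rmin_r (r - m) (eps / (2 * (Rabs K + 1)))).
  assert (T : forall u p : C, (Cmod u <= Cmod (u - p) + Cmod p)%R).
  { intros u' p'. replace u' with ((u' - p') + p') at 1 by ring. apply Cmod_triangle. }
  pose proof (T u p). pose proof (T v q).
  specialize (HK u v p q ltac:(lra) ltac:(lra) ltac:(lra) ltac:(lra)).
  eapply Rle_trans; [exact HK|].
  pose proof (Cmod_ge_0 (u - p)). pose proof (Cmod_ge_0 (v - q)).
  set (w := (Cmod (u - p) + Cmod (v - q))%R) in *.
  assert (W : (w * (Rabs K + 1) <= eps)%R).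
  { apply Rmult_le_reg_r with (/ (Rabs K + 1))%R; [apply Rinv_0_lt_compat; lra|].
    rewrite Rmult_assoc, Rinv_r by lra.
    replace (eps / (2 * (Rabs K + 1)))%R with (eps * / (Rabs K + 1) / 2)%R in * by (field; lra).
    unfold w. lra. }
  assert (0 <= w)%R by (unfold w; lra). nra.
Qed.

Lemma holomorphic2_diff2 (Q : C -> C -> C) (p q : C) : holomorphic2_on De Q ->
  De p -> De q -> exists A B, diff2_at Q p q A B.
Proof.
  intros H Hp Hq. destruct (H p q Hp Hq) as [l [Hl Hd]].
  exists (l (RtoC 1, RtoC 0)), (l (RtoC 0, RtoC 1)). intros eps He.
  (* The product norm is at most sqrt 2 times the maximum of the moduli, hence at most twice their
     sum; eps / 2 compensates. *)
  destruct (Hd (p, q) (fun P HP => HP) (mkposreal (eps / 2) ltac:(lra))) as [d Hd'].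
  exists d. split; [apply cond_pos|]. intros u v Hu Hv.
  assert (L : l (u - p, v - q) = (u - p) * l (RtoC 1, RtoC 0) + (v - q) * l (RtoC 0, RtoC 1)).
  { pose proof (linear_plus l Hl (scal (u - p) (RtoC 1, RtoC 0)) (scal (v - q) (RtoC 0, RtoC 1))) as E.
    rewrite !(linear_scal l Hl) in E. etransitivity; [|exact E]. f_equal.
    change ((u - p, v - q)
      = ((u - p) * 1 + (v - q) * 0, (u - p) * 0 + (v - q) * 1)). f_equal; ring. }
  assert (Hb : ball (M := prod_UniformSpace C_UniformSpace C_UniformSpace) (p, q) d (u, v)
      -> (Cmod (Q u v - Q p q - ((u - p) * l (RtoC 1, RtoC 0) + (v - q) * l (RtoC 0, RtoC 1)))
           <= eps * (Cmod (u - p) + Cmod (v - q)))%R).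
  { intros Hball. specialize (Hd' (u, v) Hball). simpl in Hd'.
    rewrite <- L. eapply Rle_trans; [exact Hd'|].
    pose proof (proj2 (norm_prod (K := C_AbsRing) (U := C_NormedModule) (V := C_NormedModule) (u - p) (v - q))) as N.
    assert (HS : (sqrt 2 <= 2)%R).
    { rewrite <- (sqrt_Rsqr 2) at 2 by lra. apply sqrt_le_1_alt. unfold Rsqr; lra. }
    pose proof (Cmod_ge_0 (u - p)). pose proof (Cmod_ge_0 (v - q)).
    assert (Hmax : (Rmax (Cmod (u - p)) (Cmod (v - q)) <= Cmod (u - p) + Cmod (v - q))%R)
      by (apply Rmax_lub; lra).
    assert (N' : (norm (K := C_AbsRing) (V := prod_NormedModule C_AbsRing C_NormedModule C_NormedModule)
      ((u - p)%C, (v - q)%C) <= 2 * (Cmod (u - p) + Cmod (v - q)))%R).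
    { eapply Rle_trans; [exact N|]. apply Rmult_le_compat; [apply sqrt_pos| |exact HS|exact Hmax].
      eapply Rle_trans; [|apply Rmax_l]. apply norm_ge_0. }
    replace (eps * (Cmod (u - p) + Cmod (v - q)))%R
      with (eps / 2 * (2 * (Cmod (u - p) + Cmod (v - q))))%R by field.
    apply Rmult_le_compat_l; [lra|exact N']. }
  replace (Q u v - Q p q - (u - p) * l (RtoC 1, RtoC 0) - (v - q) * l (RtoC 0, RtoC 1))
    with (Q u v - Q p q - ((u - p) * l (RtoC 1, RtoC 0) + (v - q) * l (RtoC 0, RtoC 1))) by ring.
  apply Hb.
  assert (BB : forall a b : C, (Cmod (b - a) < d)%R -> ball (M := C_UniformSpace) a d b).
  { intros a b Hab. pose proof (Rabs_Re_le (b - a)). pose proof (Rabs_Im_le (b - a)).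
    split.
    - change (Rabs (fst b - fst a) < d)%R. unfold Re in *; simpl in *. unfold Rminus. lra.
    - change (Rabs (snd b - snd a) < d)%R. unfold Im in *; simpl in *. unfold Rminus. lra. }
  split; apply BB; assumption.
Qed.

(** * The divided difference of psi *)

(* Differentiability along pairs of curves: it gives the partial derivatives
   of F and also the derivative of t |-> F t t. *)
Definition has_partials (F F1 F2 : C -> C -> C) : Prop :=
  forall (x y : C -> C) (s a b : C), De (x s) -> De (y s) ->
    cderive x s a -> cderive y s b ->
    cderive (fun t => F (x t) (y t)) s (a * F1 (x s) (y s) + b * F2 (x s) (y s)).

Lemma has_partials_eq (F F1 F2 G1 G2 : C -> C -> C) :
  (forall z w, De z -> De w -> F1 z w = G1 z w) ->
  (forall z w, De z -> De w -> F2 z w = G2 z w) ->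
  has_partials F F1 F2 -> has_partials F G1 G2.
Proof.
  intros E1 E2 H x y s a b Hx Hy Dx Dy. rewrite <- E1, <- E2 by assumption. now apply H.
Qed.

Lemma partial_l (F F1 F2 : C -> C -> C) (z w : C) : has_partials F F1 F2 ->
  De z -> De w -> cderive (fun t => F t w) z (F1 z w).
Proof.
  intros H Hz Hw. apply (cderive_eq _ _ (1 * F1 z w + 0 * F2 z w)); [ring|].
  apply (H (fun t => t) (fun _ => w)); auto using cderive_id, cderive_const.
Qed.

Lemma partial_r (F F1 F2 : C -> C -> C) (z w : C) : has_partials F F1 F2 ->
  De z -> De w -> cderive (fun t => F z t) w (F2 z w).
Proof.
  intros H Hz Hw. apply (cderive_eq _ _ (0 * F1 z w + 1 * F2 z w)); [ring|].
  apply (H (fun _ => z) (fun t => t)); auto using cderive_id, cderive_const.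
Qed.

Lemma partial_diag (F F1 F2 : C -> C -> C) (z : C) : has_partials F F1 F2 ->
  De z -> cderive (fun t => F t t) z (F1 z z + F2 z z).
Proof.
  intros H Hz. apply (cderive_eq _ _ (1 * F1 z z + 1 * F2 z z)); [ring|].
  apply (H (fun t => t) (fun t => t)); auto using cderive_id.
Qed.

Lemma has_partials_plus (F F1 F2 G G1 G2 : C -> C -> C) :
  has_partials F F1 F2 -> has_partials G G1 G2 ->
  has_partials (fun z w => F z w + G z w) (fun z w => F1 z w + G1 z w)
    (fun z w => F2 z w + G2 z w).
Proof.
  intros HF HG x y s a b Hx Hy Dx Dy.
  eapply cderive_eq; [|apply (cderive_plus _ _ _ _ _ (HF x y s a b Hx Hy Dx Dy)
                                 (HG x y s a b Hx Hy Dx Dy))].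
  ring.
Qed.

Lemma has_partials_mult (F F1 F2 G G1 G2 : C -> C -> C) :
  has_partials F F1 F2 -> has_partials G G1 G2 ->
  has_partials (fun z w => F z w * G z w)
    (fun z w => F1 z w * G z w + F z w * G1 z w)
    (fun z w => F2 z w * G z w + F z w * G2 z w).
Proof.
  intros HF HG x y s a b Hx Hy Dx Dy.
  eapply cderive_eq; [|apply (cderive_mult _ _ _ _ _ (HF x y s a b Hx Hy Dx Dy)
                                 (HG x y s a b Hx Hy Dx Dy))].
  ring.
Qed.

Lemma has_partials_comp (f f' : C -> C) (F F1 F2 : C -> C -> C) :
  (forall z w, De z -> De w -> cderive f (F z w) (f' (F z w))) ->
  has_partials F F1 F2 ->
  has_partials (fun z w => f (F z w))
    (fun z w => f' (F z w) * F1 z w) (fun z w => f' (F z w) * F2 z w).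
Proof.
  intros Hf HF x y s a b Hx Hy Dx Dy.
  eapply cderive_eq; [|apply (cderive_comp f _ _ _ _ (Hf _ _ Hx Hy)
                                 (HF x y s a b Hx Hy Dx Dy))].
  ring.
Qed.

Lemma has_partials_const (a : C) :
  has_partials (fun _ _ => a) (fun _ _ => 0) (fun _ _ => 0).
Proof.
  intros x y s b c _ _ _ _. apply (cderive_eq _ _ 0); [ring|apply cderive_const].
Qed.

Lemma De_neq_0 (z : C) : De z -> z <> 0.
Proof. unfold De. intros H. apply Cmod_gt_0. lra. Qed.

Lemma De_inv (z : C) : De z -> (Cmod (/ z) < 1)%R.
Proof.
  intros H. rewrite Cmod_inv by now apply De_neq_0. unfold De in H.
  rewrite <- Rinv_1. apply Rinv_lt_contravar; lra.
Qed.

Lemma has_partials_inv_l :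
  has_partials (fun z _ => / z) (fun z _ => - (/ z * / z)) (fun _ _ => 0).
Proof.
  intros x y s a b Hx _ Dx _.
  apply (cderive_eq _ _ (a * - (/ x s * / x s))); [ring|].
  apply (cderive_comp Cinv x); [apply cderive_inv; now apply De_neq_0|exact Dx].
Qed.

Lemma has_partials_inv_r :
  has_partials (fun _ w => / w) (fun _ _ => 0) (fun _ w => - (/ w * / w)).
Proof.
  intros x y s a b _ Hy _ Dy.
  apply (cderive_eq _ _ (b * - (/ y s * / y s))); [ring|].
  apply (cderive_comp Cinv y); [apply cderive_inv; now apply De_neq_0|exact Dy].
Qed.

Lemma has_partials_PS2 (c : nat -> nat -> C) : bidisc_coef c ->
  has_partials (fun z w => PS2 c (/ z) (/ w))
    (fun z w => - (/ z * / z) * PS2 (dx c) (/ z) (/ w))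
    (fun z w => - (/ w * / w) * PS2 (dy c) (/ z) (/ w)).
Proof.
  intros Hc x y s a b Hx Hy Dx Dy.
  eapply cderive_eq; [|apply (diff2_at_chain (PS2 c) (PS2 (dx c) (/ x s) (/ y s))
    (PS2 (dy c) (/ x s) (/ y s)) (fun t => / x t) (fun t => / y t) s)].
  2: now apply PS2_diff2; try apply De_inv.
  2: exact (has_partials_inv_l x y s a b Hx Hy Dx Dy).
  2: exact (has_partials_inv_r x y s a b Hx Hy Dx Dy).
  simpl. ring.
Qed.

Lemma dx_dy_comm (c : nat -> nat -> C) : dx (dy c) = dy (dx c).
Proof.
  apply functional_extensionality; intros i; apply functional_extensionality; intros j.
  unfold dx, dy. ring.
Qed.

(* The coefficients of [sum_n b (n+1) sum_(i+j=n) x^i y^j] and of its partial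
   derivatives. *)
Definition hcoef (b : nat -> C) (m n : nat) : nat -> nat -> C :=
  Nat.iter m dx (Nat.iter n dy (fun i j => b (S (i + j)))).

Lemma hcoef_dy (b : nat -> C) (m n : nat) : dy (hcoef b m n) = hcoef b m (S n).
Proof.
  unfold hcoef. induction m as [|m IH]; [reflexivity|]. simpl in *.
  now rewrite <- dx_dy_comm, IH.
Qed.

(** At z = 1 / r the terms of the convergent Laurent series are b_n r^n, and they are bounded. *)
Lemma laurent_bidisc (b : nat -> C) (f : C -> C) :
  (forall z, De z -> is_series (K := C_AbsRing) (V := C_NormedModule)
     (fun n => b n / z ^ n) (f z)) ->
  forall r : R, (0 < r < 1)%R -> exists K, forall n, (Cmod (b n) * r ^ n <= K)%R.
Proof.
  intros H r Hr. assert (Hr0 : RtoC r <> 0) by (intros E; apply RtoC_inj in E; lra).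
  assert (Hz : De (/ RtoC r)).
  { unfold De. rewrite Cmod_inv, Cmod_R, Rabs_pos_eq by (auto; lra).
    rewrite <- Rinv_1. apply Rinv_lt_contravar; lra. }
  destruct (CSeries_terms_bounded _ _ (H _ Hz)) as [K HK]. exists K. intros n.
  specialize (HK n). replace (b n / (/ RtoC r) ^ n) with (b n * RtoC r ^ n) in HK.
  - rewrite Cmod_mult, Cmod_pow, Cmod_R, Rabs_pos_eq in HK by lra. exact HK.
  - rewrite Cpow_inv by assumption. field. now apply Cpow_nz.
Qed.

Lemma hcoef_bidisc (b : nat -> C) (m n : nat) :
  (forall r : R, (0 < r < 1)%R -> exists K, forall n, (Cmod (b n) * r ^ n <= K)%R) ->
  bidisc_coef (hcoef b m n).
Proof.
  intros H.
  assert (H0 : bidisc_coef (fun i j => b (S (i + j)))).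
  { intros r Hr. destruct (H r Hr) as [K HK]. exists (K / r)%R. intros i j.
    specialize (HK (S (i + j))). simpl pow in HK. apply Rmult_le_reg_r with r; [lra|].
    unfold Rdiv. rewrite (Rmult_assoc K), Rinv_l, Rmult_1_r by lra. lra. }
  unfold hcoef. induction m as [|m IH]; simpl; [|now apply bidisc_coef_dx].
  induction n as [|n IH]; simpl; [exact H0|now apply bidisc_coef_dy].
Qed.

Lemma Cpow_minus_factor (x y : C) (n : nat) :
  x ^ S n - y ^ S n = (x - y) * sum_n (fun i => x ^ i * y ^ (n - i)) n.
Proof.
  induction n as [|n IH]; [rewrite Csum_O; simpl; ring|].
  rewrite Csum_S, Nat.sub_diag.
  rewrite (Csum_ext _ (fun i => y * (x ^ i * y ^ (n - i)))).
  2:{ intros k Hk. replace (S n - k)%nat with (S (n - k)) by lia. rewrite Cpow_S. ring. }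
  rewrite Csum_scal.
  transitivity (y * (x ^ S n - y ^ S n) + (x - y) * x ^ S n); [rewrite !Cpow_S; ring|].
  rewrite IH. simpl (y ^ 0). ring.
Qed.

Lemma power_series_summable (b : nat -> C) (x : C) :
  (forall r : R, (0 < r < 1)%R -> exists K, forall n, (Cmod (b n) * r ^ n <= K)%R) ->
  (Cmod x < 1)%R -> summable (fun n => b n * x ^ n).
Proof.
  intros H Hx. pose proof (Cmod_ge_0 x) as Hx0. set (r := ((Cmod x + 1) / 2)%R).
  assert (Hr : (0 < r < 1)%R) by (unfold r; lra). assert (Hxr : (Cmod x < r)%R) by (unfold r; lra).
  destruct (H r Hr) as [K HK].
  apply (summable_le _ (fun n => K * (Cmod x / r) ^ n)%R).
  - intros n. rewrite Cmod_mult, Cmod_pow. unfold Rdiv. rewrite Rpow_mult_distr, pow_inv.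
    assert (Hrn : (0 < r ^ n)%R) by (apply pow_lt; lra).
    replace (K * (Cmod x ^ n * / r ^ n))%R with (K * / r ^ n * Cmod x ^ n)%R by ring.
    apply Rmult_le_compat_r; [now apply pow_le|].
    apply Rmult_le_reg_r with (r ^ n)%R; [exact Hrn|].
    rewrite Rmult_assoc, Rinv_l, Rmult_1_r by lra. apply HK.
  - apply (ex_series_scal (K := R_AbsRing) (V := R_NormedModule) K (fun n => (Cmod x / r) ^ n)%R).
    apply ex_series_geom. rewrite Rabs_pos_eq.
    + apply Rmult_lt_reg_r with r; [lra|]. unfold Rdiv. rewrite Rmult_assoc, Rinv_l by lra. lra.
    + apply Rmult_le_pos; [lra|]. apply Rlt_le, Rinv_0_lt_compat. lra.
Qed.

(** Each x^n - y^n is divided by x - y separately. The constant term cancels, which is why [hcoef]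
    begins with b_1. *)
Lemma power_series_divided_difference (b : nat -> C) (x y : C) :
  (forall r : R, (0 < r < 1)%R -> exists K, forall n, (Cmod (b n) * r ^ n <= K)%R) ->
  (Cmod x < 1)%R -> (Cmod y < 1)%R ->
  CSeries (fun n => b n * x ^ n) - CSeries (fun n => b n * y ^ n)
    = (x - y) * PS2 (hcoef b 0 0) x y.
Proof.
  intros H Hx Hy.
  assert (Sx := power_series_summable b x H Hx). assert (Sy := power_series_summable b y H Hy).
  pose proof (Cmod_ge_0 x). pose proof (Cmod_ge_0 y).
  set (m := Rmax (Cmod x) (Cmod y)).
  assert (Hm : (m < 1)%R) by now apply Rmax_lub_lt.
  pose proof (Rmax_l (Cmod x) (Cmod y)) as M1. pose proof (Rmax_r (Cmod x) (Cmod y)) as M2.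
  fold m in M1, M2.
  assert (Sh : summable (hterm (hcoef b 0 0) x y)).
  { apply (hterm_summable _ _ _ ((m + 1) / 2)); try lra. now apply hcoef_bidisc. }
  unfold PS2. rewrite <- CSeries_scal by assumption.
  assert (Sd := summable_plus _ _ Sx (summable_scal (- (1)) _ Sy)).
  transitivity (CSeries (fun n => b n * x ^ n + - (1) * (b n * y ^ n))).
  { rewrite CSeries_plus, CSeries_scal by auto using summable_scal. ring. }
  rewrite CSeries_head by assumption. simpl (x ^ 0). simpl (y ^ 0).
  transitivity (CSeries (fun n => b (S n) * x ^ S n + - (1) * (b (S n) * y ^ S n))); [ring|].
  apply CSeries_ext. intros n.
  transitivity (b (S n) * (x ^ S n - y ^ S n)); [ring|].
  rewrite Cpow_minus_factor. unfold hterm, hcoef. simpl Nat.iter.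
  rewrite (Csum_ext (fun i => b (S (i + (n - i))) * (x ^ i * y ^ (n - i)))
             (fun i => b (S n) * (x ^ i * y ^ (n - i)))).
  - rewrite Csum_scal. ring.
  - intros i Hi. now replace (i + (n - i))%nat with n by lia.
Qed.

(** From 1/z - 1/w = - (z - w) / (z w): dividing psi z - psi w by z - w leaves a formula that still
    makes sense at z = w. *)
Definition Gfun (b : nat -> C) (z w : C) : C :=
  1 - / z * / w * PS2 (hcoef b 0 0) (/ z) (/ w).

Lemma Gfun_off_diag (b : nat -> C) (psi : C -> C) :
  (forall z, De z -> is_series (K := C_AbsRing) (V := C_NormedModule)
     (fun n => b n / z ^ n) (psi z - z)) ->
  forall z w, De z -> De w -> z <> w -> Gfun b z w = (psi z - psi w) / (z - w).
Proof.
  intros H z w Hz Hw Hzw.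
  assert (Hb := laurent_bidisc b (fun z => psi z - z) H).
  assert (E : forall z, De z -> CSeries (fun n => b n * (/ z) ^ n) = psi z - z).
  { intros u Hu. rewrite <- (CSeries_unique _ _ (H u Hu)). apply CSeries_ext. intros n.
    unfold Cdiv. now rewrite Cpow_inv by now apply De_neq_0. }
  assert (D := power_series_divided_difference b (/ z) (/ w) Hb (De_inv z Hz) (De_inv w Hw)).
  rewrite (E z Hz), (E w Hw) in D.
  assert (Hz0 := De_neq_0 z Hz). assert (Hw0 := De_neq_0 w Hw).
  assert (Hd : z - w <> 0) by (intros K; apply Hzw; replace z with ((z - w) + w) by ring; rewrite K; ring).
  replace (psi z - psi w) with ((psi z - z - (psi w - w)) + (z - w)) by ring. rewrite D.
  unfold Gfun. field. auto.
Qed.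

(** Uniqueness of continuous extension: it carries exp Q = G from the complement of the diagonal to
    the diagonal itself. If the values at z differed by D, the Lipschitz bound on f - g would give
    |D| <= K |t - z| for t near z. *)
Lemma cderive_eq_at (f g : C -> C) (z l m : C) : De z ->
  (forall t, De t -> t <> z -> f t = g t) -> cderive f z l -> cderive g z m -> f z = g z.
Proof.
  intros Hz E Hf Hg.
  assert (HD : cderive (fun t => f t + - (1) * g t) z (l + - (1) * m)).
  { apply cderive_plus; [exact Hf|]. now apply cderive_scal. }
  destruct (cderive_lipschitz _ _ _ HD) as [d [Hd H]].
  destruct (De_open z Hz) as [d' [Hd' H']].
  set (K := (Cmod (l + - (1) * m) + 1)%R) in *.
  assert (HK : (0 < K)%R) by (unfold K; pose proof (Cmod_ge_0 (l + - (1) * m)); lra).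
  destruct (Ceq_dec (f z) (g z)) as [|Hne]; [assumption|exfalso].
  set (D := f z + - (1) * g z).
  assert (HDn : (0 < Cmod D)%R).
  { apply Cmod_gt_0. intros K0. apply Hne. transitivity (D + g z); [unfold D; ring|].
    rewrite K0. ring. }
  (* Halving makes the contradiction strict: K e <= |D| / 2 at the test point z + e. *)
  set (e := (Rmin (Rmin d d') (Cmod D / K) / 2)%R).
  assert (HDK := Rdiv_lt_0_compat _ _ HDn HK).
  assert (He : (0 < e)%R).
  { unfold e. assert (0 < Rmin (Rmin d d') (Cmod D / K))%R by (repeat apply Rmin_glb_lt; assumption). lra. }
  assert (He2 : (2 * e = Rmin (Rmin d d') (Cmod D / K))%R) by (unfold e; field).
  pose proof (Rmin_l (Rmin d d') (Cmod D / K)). pose proof (Rmin_r (Rmin d d') (Cmod D / K)).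
  pose proof (Rmin_l d d'). pose proof (Rmin_r d d').
  set (t := z + RtoC e).
  assert (Ht : Cmod (t - z) = e).
  { unfold t. replace (z + RtoC e - z) with (RtoC e) by ring.
    rewrite Cmod_R, Rabs_pos_eq by lra. reflexivity. }
  assert (Htz : t <> z).
  { intros Et. rewrite Et in Ht. replace (z - z) with (RtoC 0) in Ht by ring. rewrite Cmod_0 in Ht. lra. }
  assert (HtD : De t) by (apply H'; rewrite Ht; lra).
  specialize (H t ltac:(rewrite Ht; lra)). cbv beta in H.
  rewrite (E t HtD Htz), Ht in H.
  replace (g t + - (1) * g t - (f z + - (1) * g z)) with (- D) in H by (unfold D; ring).
  rewrite Cmod_opp in H.
  assert (HKe : (K * (2 * e) <= Cmod D)%R).
  { replace (Cmod D) with (K * (Cmod D / K))%R by (field; lra). apply Rmult_le_compat_l; lra. }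
  nra.
Qed.

(** * Existence of all partial derivatives of Q *)

(* The differential algebra generated by Q, by the partial derivatives [JV m n]
   of [sum_n b (n+1) sum_(i+j=n) x^i y^j] at x = 1/z, y = 1/w, and by
   [JX] = 1/z, [JY] = 1/w, [JInv] = exp (- Q). *)
Inductive jexpr : Type :=
| JConst : C -> jexpr
| JX : jexpr
| JY : jexpr
| JV : nat -> nat -> jexpr
| JInv : jexpr
| JQ : jexpr
| JAdd : jexpr -> jexpr -> jexpr
| JMul : jexpr -> jexpr -> jexpr.

Fixpoint jeval (b : nat -> C) (Q : C -> C -> C) (e : jexpr) (z w : C) : C :=
  match e with
  | JConst a => a
  | JX => / z
  | JY => / w
  | JV m n => PS2 (hcoef b m n) (/ z) (/ w)
  | JInv => / Gfun b z w
  | JQ => Q z w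
  | JAdd e1 e2 => jeval b Q e1 z w + jeval b Q e2 z w
  | JMul e1 e2 => jeval b Q e1 z w * jeval b Q e2 z w
  end.

(* Partial derivatives of [Gfun], i.e. of 1 - X Y V00. *)
Definition dzG : jexpr :=
  JMul (JMul JX (JMul JX JY)) (JAdd (JV 0 0) (JMul JX (JV 1 0))).
Definition dwG : jexpr :=
  JMul (JMul JX (JMul JY JY)) (JAdd (JV 0 0) (JMul JY (JV 0 1))).

(** The rule for [JQ] is the logarithmic derivative G_z / G. It stays inside the algebra, so one
    derivative of every expression already yields all orders. *)
Fixpoint jdz (e : jexpr) : jexpr :=
  match e with
  | JConst _ | JY => JConst 0
  | JX => JMul (JConst (-(1))) (JMul JX JX)
  | JV m n => JMul (JMul (JConst (-(1))) (JMul JX JX)) (JV (S m) n)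
  | JInv => JMul (JMul (JConst (-(1))) (JMul JInv JInv)) dzG
  | JQ => JMul dzG JInv
  | JAdd e1 e2 => JAdd (jdz e1) (jdz e2)
  | JMul e1 e2 => JAdd (JMul (jdz e1) e2) (JMul e1 (jdz e2))
  end.

Fixpoint jdw (e : jexpr) : jexpr :=
  match e with
  | JConst _ | JX => JConst 0
  | JY => JMul (JConst (-(1))) (JMul JY JY)
  | JV m n => JMul (JMul (JConst (-(1))) (JMul JY JY)) (JV m (S n))
  | JInv => JMul (JMul (JConst (-(1))) (JMul JInv JInv)) dwG
  | JQ => JMul dwG JInv
  | JAdd e1 e2 => JAdd (jdw e1) (jdw e2)
  | JMul e1 e2 => JAdd (JMul (jdw e1) e2) (JMul e1 (jdw e2))
  end.

(** The two syntax trees differ; their values agree by a polynomial identity in the generators,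
    whatever b and Q are. *)
Lemma jdz_jdw_comm (b : nat -> C) (Q : C -> C -> C) (e : jexpr) (z w : C) :
  jeval b Q (jdz (jdw e)) z w = jeval b Q (jdw (jdz e)) z w.
Proof.
  induction e as [a| | |m n| | |e1 IH1 e2 IH2|e1 IH1 e2 IH2]; simpl in *; try ring.
  - now rewrite IH1, IH2.
  - rewrite IH1, IH2. ring.
Qed.

Lemma has_partials_V (b : nat -> C) (Q : C -> C -> C) (m n : nat) :
  (forall r : R, (0 < r < 1)%R -> exists K, forall n, (Cmod (b n) * r ^ n <= K)%R) ->
  has_partials (jeval b Q (JV m n)) (jeval b Q (jdz (JV m n))) (jeval b Q (jdw (JV m n))).
Proof.
  intros Hb. eapply has_partials_eq; [| |apply has_partials_PS2; now apply hcoef_bidisc].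
  - intros z w _ _. simpl. change (dx (hcoef b m n)) with (hcoef b (S m) n). ring.
  - intros z w _ _. simpl. rewrite hcoef_dy. ring.
Qed.

Lemma has_partials_Gfun (b : nat -> C) (Q : C -> C -> C) :
  (forall r : R, (0 < r < 1)%R -> exists K, forall n, (Cmod (b n) * r ^ n <= K)%R) ->
  has_partials (Gfun b) (jeval b Q dzG) (jeval b Q dwG).
Proof.
  intros Hb.
  assert (H : has_partials (fun z w => 1 + - (1) * (/ z * (/ w * PS2 (hcoef b 0 0) (/ z) (/ w))))
                (jeval b Q dzG) (jeval b Q dwG)).
  { eapply has_partials_eq; [| |
      apply (has_partials_plus (fun _ _ => 1)); [apply has_partials_const|];
      apply (has_partials_mult (fun _ _ => - (1))); [apply has_partials_const|];
      apply (has_partials_mult (fun z _ => / z)); [apply has_partials_inv_l|];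
      apply (has_partials_mult (fun _ w => / w)); [apply has_partials_inv_r|];
      exact (has_partials_V b Q 0 0 Hb)]; intros z w _ _; simpl; ring. }
  intros x y s p q Hx Hy Dx Dy.
  apply (cderive_ext (fun t => 1 + - (1) * (/ x t * (/ y t * PS2 (hcoef b 0 0) (/ x t) (/ y t))))).
  - intros t. unfold Gfun. ring.
  - now apply H.
Qed.

Lemma Cexp_Q_Gfun (psi : C -> C) (Q : C -> C -> C) (b : nat -> C) : is_Qe psi Q ->
  (forall z, De z -> is_series (K := C_AbsRing) (V := C_NormedModule)
     (fun n => b n / z ^ n) (psi z - z)) ->
  forall z w, De z -> De w -> Cexp (Q z w) = Gfun b z w.
Proof.
  intros HQ Hb. assert (Hb' := laurent_bidisc b (fun z => psi z - z) Hb).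
  assert (Off : forall z w, De z -> De w -> z <> w -> Cexp (Q z w) = Gfun b z w).
  { intros z w Hz Hw Hzw. rewrite (Qe_off_diag _ _ HQ z w Hz Hw Hzw).
    symmetry. now apply Gfun_off_diag. }
  intros z w Hz Hw. destruct (Ceq_dec z w) as [<-|Hne]; [|now apply Off].
  destruct (holomorphic2_diff2 Q z z (Qe_holo _ _ HQ) Hz Hz) as [A [B HAB]].
  refine (cderive_eq_at (fun t => Cexp (Q t z)) (fun t => Gfun b t z) z _ _ Hz _ _ _).
  - intros t Ht Htz. now apply Off.
  - apply cderive_comp; [apply cderive_Cexp|].
    exact (diff2_at_chain Q A B (fun t => t) (fun _ => z) z 1 0 HAB
             (cderive_id z) (cderive_const z z)).
  - exact (partial_l _ _ _ z z (has_partials_Gfun b Q Hb') Hz Hz).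
Qed.

(** Differentiability of Q with some partials A, B is given; differentiating exp Q = G in each
    variable and dividing by G, which is nonzero as an exponential, identifies them. *)
Lemma has_partials_Q (psi : C -> C) (Q : C -> C -> C) (b : nat -> C) : is_Qe psi Q ->
  (forall z, De z -> is_series (K := C_AbsRing) (V := C_NormedModule)
     (fun n => b n / z ^ n) (psi z - z)) ->
  has_partials Q (jeval b Q (jdz JQ)) (jeval b Q (jdw JQ)).
Proof.
  intros HQ Hb x y s p q Hx Hy Dx Dy.
  assert (Hb' := laurent_bidisc b (fun z => psi z - z) Hb).
  destruct (holomorphic2_diff2 Q (x s) (y s) (Qe_holo _ _ HQ) Hx Hy) as [A [B HAB]].
  assert (HG := has_partials_Gfun b Q Hb').
  assert (E := Cexp_Q_Gfun psi Q b HQ Hb).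
  assert (N : Gfun b (x s) (y s) <> 0) by (rewrite <- E by assumption; apply Cexp_neq_0).
  assert (EA : A = jeval b Q (jdz JQ) (x s) (y s)).
  { assert (D : cderive (fun t => Cexp (Q t (y s))) (x s)
                  ((1 * A + 0 * B) * Cexp (Q (x s) (y s)))).
    { apply (cderive_comp Cexp (fun t => Q t (y s))); [apply cderive_Cexp|].
      exact (diff2_at_chain Q A B (fun t => t) (fun _ => y s) (x s) 1 0 HAB
             (cderive_id _) (cderive_const _ _)). }
    assert (D' := partial_l _ _ _ (x s) (y s) HG Hx Hy).
    apply (cderive_ext_De _ (fun t => Gfun b t (y s)) _ _ Hx) in D; [|intros t Ht; now apply E].
    assert (U := cderive_unique _ _ _ _ D D'). rewrite E in U by assumption.
    change (jeval b Q (jdz JQ) (x s) (y s))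
      with (jeval b Q dzG (x s) (y s) * / Gfun b (x s) (y s)).
    rewrite <- U. field. exact N. }
  assert (EB : B = jeval b Q (jdw JQ) (x s) (y s)).
  { assert (D : cderive (fun t => Cexp (Q (x s) t)) (y s)
                  ((0 * A + 1 * B) * Cexp (Q (x s) (y s)))).
    { apply (cderive_comp Cexp (fun t => Q (x s) t)); [apply cderive_Cexp|].
      exact (diff2_at_chain Q A B (fun _ => x s) (fun t => t) (y s) 0 1 HAB
             (cderive_const _ _) (cderive_id _)). }
    assert (D' := partial_r _ _ _ (x s) (y s) HG Hx Hy).
    apply (cderive_ext_De _ (fun t => Gfun b (x s) t) _ _ Hy) in D; [|intros t Ht; now apply E].
    assert (U := cderive_unique _ _ _ _ D D'). rewrite E in U by assumption.
    change (jeval b Q (jdw JQ) (x s) (y s))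
      with (jeval b Q dwG (x s) (y s) * / Gfun b (x s) (y s)).
    rewrite <- U. field. exact N. }
  rewrite <- EA, <- EB. now apply diff2_at_chain.
Qed.

Lemma has_partials_jeval (psi : C -> C) (Q : C -> C -> C) (b : nat -> C) (e : jexpr) :
  is_Qe psi Q ->
  (forall z, De z -> is_series (K := C_AbsRing) (V := C_NormedModule)
     (fun n => b n / z ^ n) (psi z - z)) ->
  has_partials (jeval b Q e) (jeval b Q (jdz e)) (jeval b Q (jdw e)).
Proof.
  intros HQ Hb. assert (Hb' := laurent_bidisc b (fun z => psi z - z) Hb).
  induction e as [a| | |m n| | |e1 IH1 e2 IH2|e1 IH1 e2 IH2].
  - apply has_partials_const.
  - eapply has_partials_eq; [| |apply has_partials_inv_l]; intros z w _ _; simpl; ring.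
  - eapply has_partials_eq; [| |apply has_partials_inv_r]; intros z w _ _; simpl; ring.
  - now apply has_partials_V.
  - eapply has_partials_eq; [| |apply (has_partials_comp Cinv (fun u => - (/ u * / u)) (Gfun b));
                                [|exact (has_partials_Gfun b Q Hb')]].
    + intros z w _ _. simpl. ring.
    + intros z w _ _. simpl. ring.
    + intros z w Hz Hw. apply cderive_inv. rewrite <- (Cexp_Q_Gfun psi Q b HQ Hb z w Hz Hw).
      apply Cexp_neq_0.
  - now apply (has_partials_Q psi).
  - now apply has_partials_plus.
  - now apply has_partials_mult.
Qed.

(** [J m n] stands for the partial derivative of order m in z and n in w of [J 0 0]; a single doubly
    indexed family builds in the commutation of mixed partials. *)
Definition jets (J : nat -> nat -> C -> C -> C) : Prop :=
  forall m n, has_partials (J m n) (J (S m) n) (J m (S n)).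

Lemma jets_exist (psi : C -> C) (Q : C -> C -> C) : Sigma psi -> is_Qe psi Q ->
  exists J, J 0%nat 0%nat = Q /\ jets J.
Proof.
  intros Hpsi HQ. destruct (Sigma_laurent psi Hpsi) as [b Hb].
  assert (P := fun e => has_partials_jeval psi Q b e HQ Hb).
  exists (fun m n => jeval b Q (Nat.iter m jdz (Nat.iter n jdw JQ))). split; [reflexivity|].
  (* [jdz] acts on syntax, while commutation is known only for values. Uniqueness of the derivative
     lets [jdz] respect equality of values on the open domain. *)
  assert (Cg : forall e1 e2, (forall z w, De z -> De w -> jeval b Q e1 z w = jeval b Q e2 z w) ->
    forall z w, De z -> De w -> jeval b Q (jdz e1) z w = jeval b Q (jdz e2) z w).
  { intros e1 e2 E z w Hz Hw.
    assert (D1 := partial_l _ _ _ z w (P e1) Hz Hw). assert (D2 := partial_l _ _ _ z w (P e2) Hz Hw).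
    apply (cderive_ext_De _ (fun t => jeval b Q e2 t w) _ _ Hz) in D1; [|intros t Ht; now apply E].
    exact (cderive_unique _ _ _ _ D1 D2). }
  assert (Cm : forall m e z w, De z -> De w ->
    jeval b Q (jdw (Nat.iter m jdz e)) z w = jeval b Q (Nat.iter m jdz (jdw e)) z w).
  { induction m as [|m IH]; intros e z w Hz Hw; [reflexivity|]. simpl.
    rewrite <- jdz_jdw_comm. apply Cg; [|assumption|assumption]. intros; now apply IH. }
  intros m n. eapply has_partials_eq; [| |apply P]; intros z w Hz Hw.
  - reflexivity.
  - simpl. now apply Cm.
Qed.

Lemma Cexp_Q_sym (psi : C -> C) (Q : C -> C -> C) : is_Qe psi Q ->
  forall z w, De z -> De w -> Cexp (Q z w) = Cexp (Q w z).
Proof.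
  intros HQ z w Hz Hw. destruct (Ceq_dec z w) as [<-|Hne]; [reflexivity|].
  rewrite !(Qe_off_diag _ _ HQ) by auto.
  assert (z - w <> 0) by (intros K; apply Hne; replace z with ((z - w) + w) by ring; rewrite K; ring).
  assert (w - z <> 0) by (intros K; apply Hne; replace w with ((w - z) + z) by ring; rewrite K; ring).
  field. auto.
Qed.

(** * Diagonal derivatives and power sums *)

Lemma C_derive_n_family (f : C -> C) (g : nat -> C -> C) :
  (forall z, De z -> f z = g 0%nat z) ->
  (forall n z, De z -> cderive (g n) z (g (S n) z)) ->
  forall n z, De z -> C_derive_n f n z = g n z.
Proof.
  intros H0 H n. induction n as [|n IH]; intros z Hz; simpl; [now apply H0|].
  apply C_derive_unique, (cderive_ext_De (g n)); [exact Hz| |now apply H].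
  intros t Ht. symmetry. now apply IH.
Qed.

Lemma mixed_derive_jets (J : nat -> nat -> C -> C -> C) (n m : nat) (z w : C) :
  jets J -> De z -> De w -> mixed_derive (J 0%nat 0%nat) n m z w = J n m z w.
Proof.
  intros HJ Hz Hw. unfold mixed_derive.
  refine (C_derive_n_family _ (fun n z => J n m z w) _ _ n z Hz).
  - intros u Hu. refine (C_derive_n_family _ (fun m w => J 0%nat m u w) _ _ m w Hw).
    + reflexivity.
    + intros k v Hv. exact (partial_r _ _ _ u v (HJ 0%nat k) Hu Hv).
  - intros k u Hu. exact (partial_l _ _ _ u w (HJ k m) Hu Hw).
Qed.

(** The s-th derivative of z |-> [J m n z z], the analogue of (x + y)^s x^m y^n. *)
Fixpoint diag_derive (J : nat -> nat -> C -> C -> C) (s m n : nat) (z : C) : C :=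
  match s with
  | O => J m n z z
  | S s' => diag_derive J s' (S m) n z + diag_derive J s' m (S n) z
  end.

Lemma cderive_diag_derive (J : nat -> nat -> C -> C -> C) : jets J ->
  forall s m n z, De z -> cderive (diag_derive J s m n) z (diag_derive J (S s) m n z).
Proof.
  intros HJ. induction s as [|s IH]; intros m n z Hz.
  - exact (partial_diag _ _ _ z (HJ m n) Hz).
  - exact (cderive_plus _ _ _ _ _ (IH (S m) n z Hz) (IH m (S n) z Hz)).
Qed.

Lemma derive_diag_schwarzian (J : nat -> nat -> C -> C -> C) (k s : nat) (z : C) :
  jets J -> De z ->
  C_derive_n (diag_schwarzian (J 0%nat 0%nat) k) s z = diag_derive J s k k z.
Proof.
  intros HJ Hz. apply (C_derive_n_family _ (fun s => diag_derive J s k k)); [| |exact Hz].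
  - intros u Hu. now apply mixed_derive_jets.
  - intros n u Hu. now apply cderive_diag_derive.
Qed.

(** Order one comes from differentiating the symmetric exp Q and cancelling the exponential; higher
    orders follow by differentiating the identity of the order below. *)
Lemma jets_sym (J : nat -> nat -> C -> C -> C) : jets J ->
  (forall z w, De z -> De w -> Cexp (J 0%nat 0%nat z w) = Cexp (J 0%nat 0%nat w z)) ->
  forall m n z w, (1 <= m + n)%nat -> De z -> De w -> J m n z w = J n m w z.
Proof.
  intros HJ E.
  assert (H : forall N m n, (m + n = S N)%nat -> forall z w, De z -> De w -> J m n z w = J n m w z).
  { induction N as [|N IH].
    - assert (B : forall z w, De z -> De w -> J 1%nat 0%nat z w = J 0%nat 1%nat w z).
      { intros z w Hz Hw.
        assert (D1 := cderive_comp Cexp _ _ _ _ (cderive_Cexp _)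
                        (partial_l _ _ _ z w (HJ 0%nat 0%nat) Hz Hw)).
        assert (D2 := cderive_comp Cexp _ _ _ _ (cderive_Cexp _)
                        (partial_r _ _ _ w z (HJ 0%nat 0%nat) Hw Hz)).
        apply (cderive_ext_De _ (fun t => Cexp (J 0%nat 0%nat w t)) _ _ Hz) in D1;
          [|intros t Ht; now apply E].
        assert (U := cderive_unique _ _ _ _ D1 D2). cbv beta in U. rewrite (E w z) in U by assumption.
        pose proof (Cexp_neq_0 (J 0%nat 0%nat z w)) as N0.
        replace (J 1%nat 0%nat z w)
          with (J 1%nat 0%nat z w * Cexp (J 0%nat 0%nat z w) / Cexp (J 0%nat 0%nat z w))
          by (field; exact N0).
        rewrite U. field. exact N0. }
      intros m n Hmn z w Hz Hw. destruct m as [|[|m]]; [|..|lia].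
      + replace n with 1%nat by lia. symmetry. now apply B.
      + replace n with 0%nat by lia. now apply B.
    - assert (B : forall m n, (m + n = S N)%nat -> forall z w, De z -> De w ->
        J (S m) n z w = J n (S m) w z).
      { intros m n Hmn z w Hz Hw.
        assert (D1 := partial_l _ _ _ z w (HJ m n) Hz Hw).
        assert (D2 := partial_r _ _ _ w z (HJ n m) Hw Hz).
        apply (cderive_ext_De _ (fun t => J n m w t) _ _ Hz) in D1;
          [|intros t Ht; now apply IH].
        exact (cderive_unique _ _ _ _ D1 D2). }
      intros m n Hmn z w Hz Hw. destruct m as [|m].
      + destruct n as [|n]; [lia|]. symmetry. apply B; auto; lia.
      + apply B; auto; lia. }
  intros m n z w Hmn Hz Hw. apply (H (pred (m + n))); auto; lia.
Qed.

(* With [e1 = x + y] and [e2 = x y], [(x^m + y^m) / 2] is the sum over k of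
   [tcoef m k * e1^(m-2k) * e2^k]; the recursion is
   [p_(m+2) = e1 p_(m+1) - e2 p_m]. *)
Fixpoint tcoef (m k : nat) : R :=
  match m with
  | O => match k with O => 1 | S _ => 0 end
  | S O => match k with O => 1 / 2 | S _ => 0 end
  | S (S m2 as m1) => tcoef m1 k - match k with O => 0 | S k' => tcoef m2 k' end
  end.

Lemma tcoef_SS (m k : nat) :
  tcoef (S (S m)) k = (tcoef (S m) k - match k with O => 0 | S k' => tcoef m k' end)%R.
Proof. reflexivity. Qed.

Lemma tcoef_eq0 (m k : nat) : (m < 2 * k)%nat -> tcoef m k = 0%R.
Proof.
  enough (H : forall m k, ((m < 2 * k)%nat -> tcoef m k = 0%R)
                       /\ ((S m < 2 * k)%nat -> tcoef (S m) k = 0%R)) by apply H.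
  clear m k. induction m as [|m IH]; intros k.
  - split; intros Hk; destruct k; try lia; reflexivity.
  - split; intros Hk; [now apply IH|]. rewrite tcoef_SS. destruct k as [|k]; [lia|].
    rewrite (proj2 (IH (S k))), (proj1 (IH k)) by lia. ring.
Qed.

(** Putting y = - x kills x + y and leaves x^(2i) = [tcoef (2 * i) i] * (- x^2)^i. *)
Lemma tcoef_top (i : nat) : tcoef (2 * i) i = ((-1) ^ i)%R.
Proof.
  induction i as [|i IH]; [reflexivity|].
  replace (2 * S i)%nat with (S (S (2 * i))) by lia.
  rewrite tcoef_SS, tcoef_eq0, IH by lia. simpl. ring.
Qed.

Lemma tcoef_0 (m : nat) : (1 <= m)%nat -> tcoef m 0 = (1 / 2)%R.
Proof.
  induction m as [|[|m] IH]; [lia|reflexivity|]. intros _. rewrite tcoef_SS, IH by lia. ring.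
Qed.

Lemma binom_n_0 (n : nat) : Binomial.C n 0 = 1%R.
Proof. unfold Binomial.C. rewrite Nat.sub_0_r. simpl. field. apply INR_fact_neq_0. Qed.

Lemma binom_n_n (n : nat) : Binomial.C n n = 1%R.
Proof. unfold Binomial.C. rewrite Nat.sub_diag. simpl. field. apply INR_fact_neq_0. Qed.

Lemma binom_SS (n k : nat) :
  Binomial.C (S n) (S k) = ((INR n + 1) / (INR k + 1) * Binomial.C n k)%R.
Proof.
  unfold Binomial.C. rewrite Nat.sub_succ, !fact_simpl, !mult_INR, !S_INR.
  pose proof (pos_INR k). pose proof (INR_fact_neq_0 k). pose proof (INR_fact_neq_0 (n - k)).
  field. repeat split; auto; lra.
Qed.

(** The Girard-Waring formula for two variables, halved. The recursion looks two steps back, hence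
    the strong induction. *)
Lemma tcoef_closed (m k : nat) : (1 <= m)%nat -> (2 * k <= m)%nat ->
  tcoef m k = ((-1) ^ k / 2 * (INR m / (INR m - INR k)) * Binomial.C (m - k) k)%R.
Proof.
  revert k. induction m as [m IH] using lt_wf_ind. intros k Hm Hk.
  pose proof (lt_0_INR m ltac:(lia)) as Hm0.
  destruct k as [|k].
  { rewrite tcoef_0, binom_n_0 by lia. simpl. field. lra. }
  destruct m as [|[|m]]; [lia|lia|]. rewrite tcoef_SS.
  (* For total index 2 the recursion reaches index 0, where the closed form would read 0 / 0. *)
  destruct m as [|m'].
  { replace k with 0%nat by lia. simpl Nat.sub. rewrite binom_n_n. simpl. field. }
  set (m := S m') in *.
  rewrite (IH m) by lia.
  set (N := (m - k)%nat).
  replace (S (S m) - S k)%nat with (S N) by lia. rewrite binom_SS.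
  assert (HN : INR m = (INR N + INR k)%R) by (unfold N; rewrite minus_INR by lia; ring).
  assert (HN1 : (1 <= INR N)%R) by (apply (le_INR 1); lia).
  pose proof (pos_INR k) as Hk0.
  assert (E : tcoef (S m) (S k) = ((-1) ^ S k / 2 * ((INR m + 1) / INR N)
                * ((INR N - INR k) / (INR k + 1) * Binomial.C N k))%R).
  { destruct (Nat.le_gt_cases (2 * S k) (S m)) as [Hle|Hgt].
    - rewrite (IH (S m)) by lia. replace (S m - S k)%nat with N by lia.
      rewrite pascal_step3 by lia. rewrite minus_INR by lia. rewrite !S_INR.
      f_equal. f_equal. f_equal. rewrite HN. ring.
    - rewrite tcoef_eq0 by lia. replace k with N by lia. field. lra. }
  rewrite E, !S_INR, HN. simpl pow. field. lra.
Qed.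

(** * The differential equation for Q_w *)

Lemma Csum_zero (f : nat -> C) (n : nat) :
  (forall k, (k <= n)%nat -> f k = 0) -> (sum_n f n : C) = 0.
Proof.
  induction n as [|n IH]; intros H; [rewrite Csum_O; now apply H|].
  rewrite Csum_S, IH, H by auto. ring.
Qed.

(** The recursion p_(m+2) = e1 p_(m+1) - e2 p_m becomes: differentiate the expansion for m + 1 along
    the diagonal and subtract the one for m at a + 1. N is only required to be large enough, since
    later coefficients vanish; this lets one bound serve several m. *)
Lemma jets_power_sum (J : nat -> nat -> C -> C -> C) : jets J ->
  (forall m n z w, (1 <= m + n)%nat -> De z -> De w -> J m n z w = J n m w z) ->
  forall m a N z, De z -> (m <= 2 * N + 1)%nat ->
    J (a + m)%nat a z z =
      sum_n (fun k => RtoC (tcoef m k) * diag_derive J (m - 2 * k) (a + k) (a + k) z) N.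
Proof.
  intros HJ Sy.
  enough (H : forall m,
    (forall a N z, De z -> (m <= 2 * N + 1)%nat -> J (a + m)%nat a z z =
      sum_n (fun k => RtoC (tcoef m k) * diag_derive J (m - 2 * k) (a + k) (a + k) z) N) /\
    (forall a N z, De z -> (S m <= 2 * N + 1)%nat -> J (a + S m)%nat a z z =
      sum_n (fun k => RtoC (tcoef (S m) k) * diag_derive J (S m - 2 * k) (a + k) (a + k) z) N))
    by (intros m; apply H).
  assert (Hd : forall (f : nat -> C) N, (forall k, (1 <= k)%nat -> f k = 0) -> (sum_n f N : C) = f 0%nat).
  { intros f N Hf. destruct N as [|N]; [apply Csum_O|]. rewrite Csum_head, Csum_zero; [ring|].
    intros k _. apply Hf. lia. }
  induction m as [|m [IH1 IH2]]; split.
  - intros a N z Hz _. rewrite Hd.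
    + rewrite !Nat.add_0_r. simpl. ring.
    + intros k Hk. rewrite tcoef_eq0 by lia. ring.
  - intros a N z Hz _. rewrite Hd.
    (* Symmetry enters the induction only here: the diagonal derivative of q_(a,a) is twice
       q_(a+1,a). *)
    + rewrite Nat.add_0_r. simpl. rewrite (Sy a (S a)) by (auto; lia).
      replace (a + 1)%nat with (S a) by lia. unfold Rdiv.
      rewrite RtoC_mult, RtoC_inv by lra. field.
    + intros k Hk. rewrite tcoef_eq0 by lia. ring.
  - exact IH2.
  - intros a N z Hz HN. destruct N as [|N]; [lia|].
    assert (D1 := partial_diag _ _ _ z (HJ (a + S m)%nat a) Hz).
    assert (D2 : cderive (fun t => sum_n (fun k => RtoC (tcoef (S m) k)
                    * diag_derive J (S m - 2 * k) (a + k) (a + k) t) (S N)) z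
       (sum_n (fun k => RtoC (tcoef (S m) k)
                    * diag_derive J (S (S m) - 2 * k) (a + k) (a + k) z) (S N))).
    { apply (cderive_sum (fun k t => RtoC (tcoef (S m) k)
                    * diag_derive J (S m - 2 * k) (a + k) (a + k) t)
        (fun k t => RtoC (tcoef (S m) k)
                    * diag_derive J (S (S m) - 2 * k) (a + k) (a + k) t)).
      intros k _. destruct (Nat.le_gt_cases (2 * k) (S m)) as [Hk|Hk].
      - apply cderive_scal. replace (S (S m) - 2 * k)%nat with (S (S m - 2 * k)) by lia.
        now apply cderive_diag_derive.
      (* The truncated order [S m - 2 * k] is meaningless here, but its coefficient is 0. *)
      - rewrite tcoef_eq0 by lia. apply (cderive_eq _ _ (0 * 0)); [ring|].
        apply (cderive_ext (fun _ => 0)); [intros t; ring|].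
        apply (cderive_eq _ _ 0); [ring|apply cderive_const]. }
    apply (cderive_ext_De _ (fun t => J (a + S m)%nat a t t) _ _ Hz) in D2;
      [|intros t Ht; symmetry; apply IH2; auto; lia].
    assert (U := cderive_unique _ _ _ _ D1 D2).
    replace (S (a + S m)) with (a + S (S m))%nat in U by lia.
    assert (I1 := IH1 (S a) N z Hz ltac:(lia)).
    replace (S a + m)%nat with (a + S m)%nat in I1 by lia.
    replace (J (a + S (S m))%nat a z z)
      with (J (a + S (S m))%nat a z z + J (a + S m)%nat (S a) z z - J (a + S m)%nat (S a) z z)
      by ring.
    rewrite U, I1, !Csum_head. rewrite (tcoef_SS m 0), Rminus_0_r.
    rewrite (Csum_ext (fun k => RtoC (tcoef (S (S m)) (S k))
        * diag_derive J (S (S m) - 2 * S k) (a + S k) (a + S k) z)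
      (fun k => RtoC (tcoef (S m) (S k)) * diag_derive J (S (S m) - 2 * S k) (a + S k) (a + S k) z
         + - (1) * (RtoC (tcoef m k) * diag_derive J (m - 2 * k) (S a + k) (S a + k) z))).
    + rewrite Csum_plus, Csum_scal. ring.
    + intros k _. rewrite tcoef_SS, RtoC_minus.
      replace (S (S m) - 2 * S k)%nat with (m - 2 * k)%nat by lia.
      replace (a + S k)%nat with (S a + k)%nat by lia. ring.
Qed.

(** Pascal's rule in the form in which the product rule produces it. *)
Lemma binomial_pascal_sum (g : nat -> C) (m : nat) :
  (sum_n (fun l => RtoC (Binomial.C m l) * (g (S l) + g l)) m : C)
    = sum_n (fun l => RtoC (Binomial.C (S m) l) * g l) (S m).
Proof.
  destruct m as [|m].
  - rewrite Csum_S, !Csum_O, !binom_n_0, binom_n_n. ring.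
  - rewrite (Csum_ext _ (fun l => RtoC (Binomial.C (S m) l) * g (S l)
               + RtoC (Binomial.C (S m) l) * g l)) by (intros; ring).
    rewrite Csum_plus, Csum_S, (Csum_head _ m), (Csum_head _ (S m)), (Csum_S _ m).
    rewrite !binom_n_0, !binom_n_n.
    rewrite (Csum_ext (fun k => RtoC (Binomial.C (S (S m)) (S k)) * g (S k))
      (fun k => RtoC (Binomial.C (S m) k) * g (S k) + RtoC (Binomial.C (S m) (S k)) * g (S k))).
    + rewrite Csum_plus. ring.
    + intros k Hk. rewrite <- pascal by lia. rewrite RtoC_plus. ring.
Qed.

Lemma cderive_leibniz (u : nat -> C -> C) (z : C) :
  (forall n, cderive (u n) z (u (S n) z)) ->
  forall m, cderive (fun t => sum_n (fun l => RtoC (Binomial.C m l) * (u l t * u (m - l)%nat t)) m) z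
    (sum_n (fun l => RtoC (Binomial.C (S m) l) * (u l z * u (S m - l)%nat z)) (S m)).
Proof.
  intros H m. rewrite <- (binomial_pascal_sum (fun l => u l z * u (S m - l)%nat z)).
  apply (cderive_eq _ _ (sum_n (fun l => RtoC (Binomial.C m l)
          * (u (S l) z * u (m - l)%nat z + u l z * u (S (m - l)) z)) m)).
  { apply Csum_ext. intros l Hl. now rewrite Nat.sub_succ, Nat.sub_succ_l by lia. }
  apply (cderive_sum (fun l t => RtoC (Binomial.C m l) * (u l t * u (m - l)%nat t))
     (fun l t => RtoC (Binomial.C m l) * (u (S l) t * u (m - l)%nat t + u l t * u (S (m - l)) t))).
  intros l _. apply cderive_scal. now apply cderive_mult.
Qed.

(* [exp Q (-1 + (z - w) Q_w) = - psi' w] does not depend on z, and neither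
   does its w-derivative. *)
Lemma Q_w_equation (psi : C -> C) (J : nat -> nat -> C -> C -> C) : jets J ->
  is_Qe psi (J 0%nat 0%nat) -> forall z w, De z -> De w ->
  (z - w) * (J 0%nat 2%nat z w + J 0%nat 1%nat z w * J 0%nat 1%nat z w)
    = 2 * J 0%nat 1%nat z w
      + 2 * J 0%nat 1%nat w w * ((z - w) * J 0%nat 1%nat z w - 1).
Proof.
  intros HJ HQ.
  assert (HP : forall z w, De z -> De w -> (z - w) * Cexp (J 0%nat 0%nat z w) = psi z - psi w).
  { intros z w Hz Hw. destruct (Ceq_dec z w) as [<-|Hne]; [ring|].
    rewrite (Qe_off_diag _ _ HQ z w Hz Hw Hne). field.
    intros K; apply Hne; replace z with ((z - w) + w) by ring; rewrite K; ring. }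
  assert (DE : forall z w, De z -> De w -> cderive (fun t => Cexp (J 0%nat 0%nat z t)) w
                 (J 0%nat 1%nat z w * Cexp (J 0%nat 0%nat z w))).
  { intros z w Hz Hw. apply (cderive_comp Cexp); [apply cderive_Cexp|].
    exact (partial_r _ _ _ z w (HJ 0%nat 0%nat) Hz Hw). }
  assert (Dh : forall z w, cderive (fun t => z - t) w (- (1))).
  { intros z w. apply (cderive_ext (fun t => z + - (1) * t)); [intros; ring|].
    apply (cderive_eq _ _ (0 + - (1) * 1)); [ring|].
    apply (cderive_plus (fun _ => z)); [apply cderive_const|]. apply cderive_scal, cderive_id. }
  assert (H1 : forall z w, De z -> De w ->
    Cexp (J 0%nat 0%nat z w) * (- (1) + (z - w) * J 0%nat 1%nat z w) = - Cexp (J 0%nat 0%nat w w)).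
  { assert (D : forall z w, De z -> De w -> cderive (fun t => psi z - psi t) w
      (Cexp (J 0%nat 0%nat z w) * (- (1) + (z - w) * J 0%nat 1%nat z w))).
    { intros z w Hz Hw.
      apply (cderive_ext_De (fun t => (z - t) * Cexp (J 0%nat 0%nat z t)) _ _ _ Hw);
        [intros t Ht; now apply HP|].
      eapply cderive_eq; [|apply (cderive_mult _ _ _ _ _ (Dh z w) (DE z w Hz Hw))].
      simpl. ring. }
    (* psi z - psi t and psi w - psi t differ by a constant in t, so their derivatives at t = w
       agree; psi' w is thereby replaced by its expression at z = w. *)
    intros z w Hz Hw. assert (D1 := D z w Hz Hw). assert (D2 := D w w Hw Hw).
    assert (D3 := cderive_plus _ _ _ _ _ (cderive_const (psi z - psi w) w) D2).
    apply (cderive_ext _ (fun t => psi z - psi t)) in D3; [|intros t; ring].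
    rewrite (cderive_unique _ _ _ _ D1 D3). ring. }
  assert (D : forall z w, De z -> De w ->
    cderive (fun t => - Cexp (J 0%nat 0%nat t t)) w
     (Cexp (J 0%nat 0%nat z w) * (- (2) * J 0%nat 1%nat z w
        + (z - w) * (J 0%nat 2%nat z w + J 0%nat 1%nat z w * J 0%nat 1%nat z w)))).
  { intros z w Hz Hw.
    apply (cderive_ext_De (fun t => Cexp (J 0%nat 0%nat z t)
        * (- (1) + (z - t) * J 0%nat 1%nat z t)) _ _ _ Hw); [intros t Ht; now apply H1|].
    assert (Da := cderive_plus (fun _ => - (1)) _ w _ _ (cderive_const _ _)
      (cderive_mult _ _ _ _ _ (Dh z w) (partial_r _ _ _ z w (HJ 0%nat 1%nat) Hz Hw))).
    eapply cderive_eq; [|exact (cderive_mult _ _ _ _ _ (DE z w Hz Hw) Da)].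
    simpl. ring. }
  intros z w Hz Hw.
  assert (U := cderive_unique _ _ _ _ (D z w Hz Hw) (D w w Hw Hw)).
  assert (V := H1 z w Hz Hw).
  set (E := Cexp (J 0%nat 0%nat z w)) in *. set (E0 := Cexp (J 0%nat 0%nat w w)) in *.
  set (v := J 0%nat 1%nat z w) in *. set (v0 := J 0%nat 1%nat w w) in *.
  set (h := z - w) in *. set (f := J 0%nat 2%nat z w + v * v) in *.
  assert (NE : E <> 0) by apply Cexp_neq_0.
  assert (K : E * (h * f) = E * (2 * v + 2 * v0 * (h * v - 1))).
  { transitivity (E * (- (2) * v + h * f) + 2 * E * v); [ring|]. rewrite U.
    replace (E * (2 * v + 2 * v0 * (h * v - 1))) with (2 * E * v + 2 * v0 * (E * (- (1) + h * v))) by ring.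
    rewrite V. ring. }
  replace (h * f) with (E * (h * f) / E) by (now field). rewrite K. now field.
Qed.

(** With w fixed, m + 1 derivatives in z at z = w turn (z - w) F into m + 1 times the m-th
    derivative of F; the factor [J 0 1 w w] is a constant in z. *)
Lemma jets_product_identity (psi : C -> C) (J : nat -> nat -> C -> C -> C) : jets J ->
  is_Qe psi (J 0%nat 0%nat) -> forall m w, De w ->
  RtoC (INR (S m)) * (J m 2%nat w w
     + sum_n (fun l => RtoC (Binomial.C m l) * (J l 1%nat w w * J (m - l)%nat 1%nat w w)) m)
  = 2 * J (S m) 1%nat w w + 2 * J 0%nat 1%nat w w * (RtoC (INR (S m)) * J m 1%nat w w).
Proof.
  intros HJ HQ m w Hw.
  pose (f := fun m z => J m 2%nat z w
     + sum_n (fun l => RtoC (Binomial.C m l) * (J l 1%nat z w * J (m - l)%nat 1%nat z w)) m).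
  assert (Df : forall m z, De z -> cderive (f m) z (f (S m) z)).
  { intros k z Hz. apply cderive_plus; [exact (partial_l _ _ _ z w (HJ k 2%nat) Hz Hw)|].
    apply (cderive_leibniz (fun l t => J l 1%nat t w)).
    intros n. exact (partial_l _ _ _ z w (HJ n 1%nat) Hz Hw). }
  assert (Dv : forall m z, De z -> cderive (fun t => J m 1%nat t w) z (J (S m) 1%nat z w)).
  { intros k z Hz. exact (partial_l _ _ _ z w (HJ k 1%nat) Hz Hw). }
  assert (Dh : forall z, cderive (fun t => t - w) z 1).
  { intros z. apply (cderive_eq _ _ (1 + 0)); [ring|].
    apply (cderive_plus (fun t => t) (fun _ => - w)); [apply cderive_id|apply cderive_const]. }
  set (P := 2 * J 0%nat 1%nat w w).
  assert (H0 : forall z, De z -> (z - w) * f 0%nat z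
      = 2 * J 0%nat 1%nat z w + P * ((z - w) * J 0%nat 1%nat z w + - (1))).
  { intros z Hz. unfold f. rewrite Csum_O, binom_n_0. simpl.
    assert (E := Q_w_equation psi J HJ HQ z w Hz Hw). fold P in E.
    transitivity ((z - w) * (J 0%nat 2%nat z w + J 0%nat 1%nat z w * J 0%nat 1%nat z w)); [ring|].
    rewrite E. ring. }
  (* [c] and [d] collect the terms in which z - w has already been differentiated. Initially they
     are the constants 0 and -1, which disappear after one derivative. *)
  assert (Step : forall m z c d d', De z ->
    (forall t, De t -> (t - w) * f m t + c t
        = 2 * J m 1%nat t w + P * ((t - w) * J m 1%nat t w + d t)) ->
    forall c', cderive c z c' -> cderive d z d' ->
    f m z + (z - w) * f (S m) z + c'
      = 2 * J (S m) 1%nat z w + P * (J m 1%nat z w + (z - w) * J (S m) 1%nat z w + d')).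
  { intros k z c d d' Hz E c' Hc Hd.
    assert (D1 := cderive_plus _ _ _ _ _
       (cderive_mult _ _ _ _ _ (Dh z) (Df k z Hz)) Hc).
    assert (D2 := cderive_plus _ _ _ _ _ (cderive_scal 2 _ _ _ (Dv k z Hz))
       (cderive_scal P _ _ _ (cderive_plus _ _ _ _ _
         (cderive_mult _ _ _ _ _ (Dh z) (Dv k z Hz)) Hd))).
    apply (cderive_ext_De _ _ _ _ Hz E) in D1.
    assert (U := cderive_unique _ _ _ _ D1 D2). cbv beta in U.
    replace (f k z) with (1 * f k z) at 1 by ring. rewrite U. ring. }
  assert (H : forall m z, De z -> (z - w) * f (S m) z + RtoC (INR (S m)) * f m z
      = 2 * J (S m) 1%nat z w
        + P * ((z - w) * J (S m) 1%nat z w + RtoC (INR (S m)) * J m 1%nat z w)).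
  { induction m0 as [|k IH]; intros z Hz.
    - assert (E := Step 0%nat z (fun _ => 0) (fun _ => - (1)) 0 Hz
        ltac:(intros t Ht; rewrite <- H0 by assumption; ring) 0
        (cderive_const _ _) (cderive_const _ _)).
      simpl INR.
      transitivity (f 0%nat z + (z - w) * f 1%nat z + 0); [ring|]. rewrite E. ring.
    - assert (E := Step (S k) z (fun t => RtoC (INR (S k)) * f k t)
        (fun t => RtoC (INR (S k)) * J k 1%nat t w) (RtoC (INR (S k)) * J (S k) 1%nat z w) Hz
        IH (RtoC (INR (S k)) * f (S k) z)
        (cderive_scal _ _ _ _ (Df k z Hz)) (cderive_scal _ _ _ _ (Dv k z Hz))).
      rewrite (S_INR (S k)), RtoC_plus.
      transitivity (f (S k) z + (z - w) * f (S (S k)) z + RtoC (INR (S k)) * f (S k) z); [ring|].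
      rewrite E. ring. }
  specialize (H m w Hw). unfold f in H at 2.
  transitivity ((w - w) * f (S m) w + RtoC (INR (S m)) * (J m 2%nat w w
     + sum_n (fun l => RtoC (Binomial.C m l) * (J l 1%nat w w * J (m - l)%nat 1%nat w w)) m)); [ring|].
  rewrite H. ring.
Qed.

(** * Coefficients of the recursion and its solution for the top term *)

Lemma sum_n_m_1_S (f : nat -> C) (n : nat) : sum_n_m f 1 (S n) = sum_n (fun k => f (S k)) n.
Proof. unfold sum_n. now rewrite <- sum_n_m_S. Qed.

Lemma INR_double (n : nat) : INR (2 * n) = (2 * INR n)%R.
Proof. rewrite mult_INR. reflexivity. Qed.

(** The origin of C_{k,j}, with j = i + 1 and k + 1 for k: the coefficient of a derivative of
    S_{2k+2} in 2/(2j+1) q_(2j+1,1) - q_(2j,2). The second expansion starts at q_(2,2), hence its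
    index shifted by one and its absence at k = 0. *)
Lemma tcoef_Ccoef (i k : nat) : (k <= i)%nat ->
  (2 / (2 * INR (S i) + 1) * tcoef (2 * S i) k
     - match k with O => 0 | S k' => tcoef (2 * i) k' end)%R
  = ((-1) ^ S k * Ccoef (S k) (S i))%R.
Proof.
  intros Hk. unfold Ccoef.
  replace (S k - 1)%nat with k by lia.
  set (N := (2 * S i - S k)%nat).
  replace (2 * S i + 1 - S k)%nat with (S N) by lia.
  rewrite tcoef_closed by lia. replace (2 * S i - k)%nat with (S N) by lia.
  assert (HN : (INR k = 2 * INR (S i) - 1 - INR N)%R).
  { unfold N. rewrite minus_INR, INR_double, (S_INR k) by lia. ring. }
  rewrite INR_double, !(S_INR k).
  pose proof (pos_INR i) as Hi0. pose proof (le_INR k i Hk) as Hki.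
  pose proof (pos_INR k) as Hk0.
  assert (HS := S_INR i).
  destruct k as [|k].
  - rewrite !binom_n_0, HS. change (INR 0) with 0%R. simpl pow. field. repeat split; lra.
  (* Every binomial becomes a rational multiple of [Binomial.C N k], which leaves an identity of
     rational functions. *)
  - rewrite tcoef_closed by lia. replace (2 * i - k)%nat with N by lia.
    rewrite binom_SS, (pascal_step3 N k) by lia. rewrite minus_INR by lia.
    rewrite INR_double. rewrite !S_INR in *.
    assert (HN' : (INR N = 2 * INR i - INR k)%R) by lra.
    rewrite HN'. simpl pow. pose proof (pos_INR k). field. repeat split; lra.
Qed.

Lemma RtoC_neq_0 (x : R) : x <> 0%R -> RtoC x <> 0.
Proof. intros H E. now apply H, RtoC_inj. Qed.

Theorem theorem4p7 (psi : C -> C) (Q : C -> C -> C)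
    (hpsi : Sigma psi) (hQ : is_Qe psi Q) :
  (forall (j : nat) (z : C), (1 <= j)%nat -> De z ->
     diag_schwarzian Q (j + 1) z =
       RtoC ((2 * INR j + 1) / (2 * INR j + 3))
         * sum_n_m (fun k : nat =>
             RtoC ((-1) ^ (j + k - 1) * Ccoef k j)
               * C_derive_n (diag_schwarzian Q k) (2 * j + 2 - 2 * k) z) 1 j
       + RtoC ((-1) ^ j * ((2 * INR j + 1) / (2 * INR j + 3)))
         * sum_n_m (fun l : nat =>
             RtoC (Binomial.C (2 * j) l)
               * Acoef Q (2 * j - l) z * Acoef Q l z) 1 (2 * j - 1))
  /\ (forall z : C, De z -> Acoef Q 1 z = diag_schwarzian Q 1 z)
  /\ (forall (n : nat) (z : C), (2 <= n)%nat -> De z ->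
        Acoef Q n z =
          RtoC ((INR n - 1) / 2)
            * sum_n_m (fun k : nat =>
                RtoC ((-1) ^ (k + 1) / (INR n - INR k)
                        * Binomial.C (n - k) (k - 1))
                  * C_derive_n (diag_schwarzian Q k) (n + 1 - 2 * k) z)
                1 (Nat.div (n + 1) 2)).
Proof.
  destruct (jets_exist psi Q hpsi hQ) as [J [<- HJ]].
  assert (Sy := jets_sym J HJ (Cexp_Q_sym psi _ hQ)).
  assert (T := jets_power_sum J HJ Sy).
  split; [|split].
  - intros j z Hj Hz. destruct j as [|i]; [lia|].
    (* [X k] is the derivative of S_{2k+2} of order 2j - 2k, where j = i + 1; [X (S i)] is the
       unknown S_{2j+2} itself. *)
    set (X := fun k => diag_derive J (2 * S i - 2 * k) (1 + k) (1 + k) z).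
    set (c := (2 * INR (S i) + 1)%R). set (d := (2 * INR (S i) + 3)%R).
    assert (Hc : (0 < c)%R) by (unfold c; pose proof (pos_INR (S i)); lra).
    assert (Hd : (0 < d)%R) by (unfold d; pose proof (pos_INR (S i)); lra).
    set (B := sum_n_m (fun l => RtoC (Binomial.C (2 * S i) l)
       * Acoef (J 0%nat 0%nat) (2 * S i - l) z * Acoef (J 0%nat 0%nat) l z) 1 (2 * S i - 1) : C).
    assert (E0 : diag_schwarzian (J 0%nat 0%nat) (S i + 1) z = X (S i)).
    { unfold diag_schwarzian. rewrite mixed_derive_jets by assumption.
      unfold X. rewrite Nat.sub_diag, Nat.add_comm. reflexivity. }
    assert (E1 : J (2 * S i)%nat 2%nat z z + B = RtoC (2 / c) * J (S (2 * S i)) 1%nat z z).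
    { assert (I := jets_product_identity psi J HJ hQ (2 * S i) z Hz).
      (* The terms l = 0 and l = 2j are both A_0 A_(2j), and together they match the last term of
         the product identity. *)
      assert (EB : sum_n (fun l => RtoC (Binomial.C (2 * S i) l)
          * (J l 1%nat z z * J (2 * S i - l)%nat 1%nat z z)) (2 * S i)
        = B + 2 * (J 0%nat 1%nat z z * J (2 * S i)%nat 1%nat z z)).
      { unfold B. replace (2 * S i - 1)%nat with (S (2 * i)) by lia.
        rewrite sum_n_m_1_S. replace (2 * S i)%nat with (S (S (2 * i))) by lia.
        rewrite Csum_S, Csum_head, binom_n_0, binom_n_n, Nat.sub_diag, Nat.sub_0_r.
        rewrite (Csum_ext (fun k => RtoC (Binomial.C (S (S (2 * i))) (S k))
            * Acoef (J 0%nat 0%nat) (S (S (2 * i)) - S k) z * Acoef (J 0%nat 0%nat) (S k) z)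
          (fun k => RtoC (Binomial.C (S (S (2 * i))) (S k))
            * (J (S k) 1%nat z z * J (S (S (2 * i)) - S k)%nat 1%nat z z))).
        - match goal with |- ?a = ?b => change (@eq C a b) end. ring.
        - intros k _. unfold Acoef. rewrite !mixed_derive_jets by assumption. ring. }
      rewrite EB in I.
      assert (Ec : RtoC (INR (S (2 * S i))) = RtoC c).
      { f_equal. unfold c. now rewrite S_INR, INR_double. }
      rewrite Ec in I. rewrite RtoC_div by lra.
      assert (Nc : RtoC c <> 0) by (apply RtoC_neq_0; lra).
      replace (RtoC 2 / RtoC c * J (S (2 * S i)) 1%nat z z)
        with (2 * J (S (2 * S i)) 1%nat z z / RtoC c) by (field; exact Nc).
      replace (2 * J (S (2 * S i)) 1%nat z z)
        with (RtoC c * (J (2 * S i)%nat 2%nat z z + B)).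
      - field. exact Nc.
      - transitivity (RtoC c * (J (2 * S i)%nat 2%nat z z
          + (B + 2 * (J 0%nat 1%nat z z * J (2 * S i)%nat 1%nat z z)))
          - 2 * J 0%nat 1%nat z z * (RtoC c * J (2 * S i)%nat 1%nat z z)); [ring|].
        rewrite I. ring. }
    assert (E2 : J (S (2 * S i)) 1%nat z z = sum_n (fun k => RtoC (tcoef (2 * S i) k) * X k) (S i)).
    { exact (T (2 * S i)%nat 1%nat (S i) z Hz ltac:(lia)). }
    assert (E3 : J (2 * S i)%nat 2%nat z z = sum_n (fun k => RtoC (tcoef (2 * i) k) * X (S k)) i).
    { replace (2 * S i)%nat with (2 + 2 * i)%nat by lia.
      rewrite (T (2 * i)%nat 2%nat i z Hz) by lia. apply Csum_ext. intros k Hk. unfold X.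
      replace (2 * S i - 2 * S k)%nat with (2 * i - 2 * k)%nat by lia. reflexivity. }
    assert (E4 : B = sum_n (fun k => RtoC ((-1) ^ S k * Ccoef (S k) (S i)) * X k) i
                     + RtoC ((-1) ^ S i * (d / c)) * X (S i)).
    { transitivity (RtoC (2 / c) * J (S (2 * S i)) 1%nat z z - J (2 * S i)%nat 2%nat z z);
        [rewrite <- E1; ring|].
      (* Padding with 0 at k = 0 lets both expansions run over the same indices. *)
      pose (e := fun k => match k with O => 0%R | S k' => tcoef (2 * i) k' end).
      replace (J (2 * S i)%nat 2%nat z z) with (sum_n (fun k => RtoC (e k) * X k) (S i)).
      2:{ rewrite E3, Csum_head.
          change (RtoC 0 * X 0%nat + sum_n (fun k => RtoC (tcoef (2 * i) k) * X (S k)) i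
            = sum_n (fun k => RtoC (tcoef (2 * i) k) * X (S k)) i). ring. }
      rewrite E2, !Csum_S.
      rewrite (Csum_ext (fun k => RtoC ((-1) ^ S k * Ccoef (S k) (S i)) * X k)
        (fun k => RtoC (2 / c) * (RtoC (tcoef (2 * S i) k) * X k) + - (1) * (RtoC (e k) * X k))).
      - rewrite Csum_plus, !Csum_scal.
        (* The two top coefficients have opposite signs, so they add up to (-1)^j (2 / c + 1), and c
           + 2 = d. *)
        replace ((-1) ^ S i * (d / c))%R with (2 / c * tcoef (2 * S i) (S i) - e (S i))%R.
        + rewrite RtoC_minus, RtoC_mult. ring.
        + unfold e. rewrite !tcoef_top. simpl pow. unfold d, c in *. field. lra.
      - intros k Hk. rewrite <- tcoef_Ccoef by exact Hk. fold c. fold (e k).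
        rewrite RtoC_minus, RtoC_mult. ring. }
    rewrite E0. fold c d. rewrite sum_n_m_1_S.
    rewrite (Csum_ext _ (fun k => RtoC (- (-1) ^ S i)
       * (RtoC ((-1) ^ S k * Ccoef (S k) (S i)) * X k))).
    2:{ intros k Hk. rewrite derive_diag_schwarzian by assumption. unfold X.
        replace (2 * S i + 2 - 2 * S k)%nat with (2 * S i - 2 * k)%nat by lia.
        replace (S i + S k - 1)%nat with (S i + k)%nat by lia.
        rewrite Cmult_assoc, <- RtoC_mult. f_equal. f_equal.
        rewrite pow_add. simpl pow. ring. }
    rewrite Csum_scal. fold B. rewrite E4.
    set (W := sum_n (fun k => RtoC ((-1) ^ S k * Ccoef (S k) (S i)) * X k) i : C).
    (* The W terms cancel and the coefficient of [X (S i)] is 1, since the sign (-1)^j occurs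
       twice. *)
    transitivity (RtoC (c / d) * (RtoC (- (-1) ^ S i) * W)
      + RtoC ((-1) ^ S i * (c / d)) * W
      + RtoC ((-1) ^ S i * (c / d)) * RtoC ((-1) ^ S i * (d / c)) * X (S i)); [|ring].
    rewrite Cmult_assoc, <- !RtoC_mult.
    replace ((-1) ^ S i * (c / d) * ((-1) ^ S i * (d / c)))%R with 1%R.
    2:{ transitivity (((-1) ^ S i * (-1) ^ S i) * (c / d * (d / c)))%R; [|ring].
        rewrite <- Rpow_mult_distr. replace (-1 * -1)%R with 1%R by ring. rewrite pow1. field. lra. }
    replace (c / d * - (-1) ^ S i)%R with (- ((-1) ^ S i * (c / d)))%R by ring.
    rewrite RtoC_opp. ring.
  - intros z Hz. reflexivity.
  - intros n z Hn Hz. unfold Acoef. rewrite mixed_derive_jets by assumption.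
    destruct n as [|m]; [lia|].
    (* Here n = m + 1 and M = floor (m / 2) is the upper limit after the shift of k. The first
       inequality is for the power-sum expansion, the second for the closed form of its
       coefficients. *)
    assert (HM : exists M, ((S m + 1) / 2 = S M /\ m <= 2 * M + 1 /\ 2 * M <= m)%nat).
    { pose proof (Nat.div_mod_eq (S m + 1) 2). pose proof (Nat.mod_upper_bound (S m + 1) 2 ltac:(lia)).
      exists (pred ((S m + 1) / 2)). lia. }
    destruct HM as [M [-> [HM1 HM2]]]. rewrite sum_n_m_1_S.
    etransitivity; [exact (T m 1%nat M z Hz HM1)|]. rewrite <- Csum_scal. apply Csum_ext. intros k Hk.
    rewrite derive_diag_schwarzian by assumption.
    replace (S m + 1 - 2 * S k)%nat with (m - 2 * k)%nat by lia.
    rewrite Cmult_assoc, <- RtoC_mult. f_equal. f_equal.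
    rewrite tcoef_closed by lia.
    replace (S m - S k)%nat with (m - k)%nat by lia. replace (S k - 1)%nat with k by lia.
    replace (S k + 1)%nat with (S (S k)) by lia.
    assert (INR k + 1 <= INR m)%R by (rewrite <- S_INR; apply le_INR; lia).
    rewrite !S_INR. simpl pow. field. lra.
Qed.
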